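(* Let $p=3$ and let $m \ge 1$ be an integer. There is a path in $\mathcal{C}^2_3$ with initial part $$(3m-2,1^2) \longrightarrow (3m-2,1^3) \longrightarrow (3m-1,1^3) \longrightarrow (3m-1,1^4) \longrightarrow (3m-1,2,1^3).$$
   Context: $\Sigma_n$ is the symmetric group on $n$ letters. $S^\lambda_{\mathbb{Z}}$ is the integral Specht module in James' convention (the $\mathbb{Z}\Sigma_n$-submodule of the permutation module on $\lambda$-tabloids spanned by polytabloids, so $S^{(n)}_{\mathbb{Z}}$ is trivial). $\mathcal{C}^2_3 := \bigcup_{n \in \mathbb{Z}_{\ge 0}} \{\lambda \vdash n \mid 3 \text{ divides } |H^2(\Sigma_n,S^\lambda_{\mathbb{Z}})|\}$, regarded as a directed graph with an arrow $\lambda \to \mu$ (for $\lambda,\mu \in \mathcal{C}^2_3$) exactly when $\mu$ is obtained from $\lambda$ by adding one node; then $\lambda$ is called a predecessor of $\mu$ in $\mathcal{C}^2_3$. A path in $\mathcal{C}^2_3$ is an infinite simple directed path whose start vertex has no predecessor in $\mathcal{C}^2_3$. Exponents in partitions denote repeated parts. *)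

(* Defs.v *)
From HB Require Import structures.
From mathcomp Require Import all_boot all_order all_algebra all_fingroup.
From mathcomp Require Import boolp classical_sets functions cardinality.

Set Implicit Arguments.
Unset Strict Implicit.
Unset Printing Implicit Defensive.

Import GRing.Theory.
Local Open Scope classical_set_scope.
Local Open Scope ring_scope.

Definition is_partition (n : nat) (l : seq nat) : bool :=
  [&& sorted geq l, 0%N \notin l & sumn l == n].

(* Nodes are pairs (row, column), counted from 0. A partition of n has at most
   n rows and n columns, so 'I_n * 'I_n contains its whole diagram. *)
Definition diagram (n : nat) (l : seq nat) : {set 'I_n * 'I_n} :=
  [set b : 'I_n * 'I_n | (b.2 < nth 0%N l b.1)%N]%SET.

(* A tableau is given by the bijection sending each entry to its node. *)
Definition is_tableau (n : nat) (l : seq nat)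
    (t : {ffun 'I_n -> 'I_n * 'I_n}) : bool :=
  injectiveb t && (t @: [set: 'I_n]%SET == diagram n l).

Definition tableau (n : nat) (l : seq nat) : Type :=
  {t : {ffun 'I_n -> 'I_n * 'I_n} | is_tableau l t}.

(* The row equivalence class of a tableau is recorded by the function sending
   each entry to its row. *)
Definition rows (n : nat) (l : seq nat) (t : tableau n l) :
    {ffun 'I_n -> 'I_n} := [ffun x => (val t x).1].

Definition tabloid (n : nat) (l : seq nat) : Type :=
  {T : {ffun 'I_n -> 'I_n} | T \in codom (@rows n l)}.

Definition tabloid_of (n : nat) (l : seq nat) (t : tableau n l) : tabloid n l :=
  exist _ (rows t) (codom_f (@rows n l) t).

Lemma tableau_act_subproof (n : nat) (l : seq nat) (s : 'S_n)
  (t : tableau n l) : is_tableau l [ffun x => val t (s x)].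
Proof.
case: t => t /= /andP[/injectiveP t_inj /eqP t_im]; apply/andP; split.
  by apply/injectiveP => x y; rewrite !ffunE => /t_inj /perm_inj.
apply/eqP; rewrite -t_im; apply/setP => b.
apply/imsetP/imsetP => -[x _ ->]; last first.
  by exists ((s^-1)%g x); rewrite ?inE // ffunE permKV.
by exists (s x); rewrite ?inE // ffunE.
Qed.

(* Permutations are composed from left to right in the library, so that
   replacing each entry x by s^-1 x is a left action of 'S_n. *)
Definition tableau_act (n : nat) (l : seq nat) (s : 'S_n) (t : tableau n l) :
    tableau n l := exist (fun t' => is_true (is_tableau l t')) _ (tableau_act_subproof s t).

Lemma tabloid_act_subproof (n : nat) (l : seq nat) (s : 'S_n)
  (T : tabloid n l) : [ffun x => val T (s x)] \in codom (@rows n l).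
Proof.
case: T => T /= /codomP[t ->]; apply/codomP; exists (tableau_act s t).
by apply/ffunP => x; rewrite !ffunE.
Qed.

Definition tabloid_act (n : nat) (l : seq nat) (s : 'S_n) (T : tabloid n l) :
    tabloid n l := exist (fun T' => is_true (T' \in codom (@rows n l))) _ (tabloid_act_subproof s T).

Lemma tabloid_of_act (n : nat) (l : seq nat) (s : 'S_n) (t : tableau n l) :
  tabloid_of (tableau_act s t) = tabloid_act s (tabloid_of t).
Proof. by apply/val_inj/ffunP => x; rewrite /= !ffunE /= ?ffunE. Qed.

(* v : permmod n l stands for the formal sum of the v T * T. *)
Definition permmod (n : nat) (l : seq nat) : Type := {ffun tabloid n l -> int}.
HB.instance Definition _ n l := GRing.Zmodule.on (permmod n l).

Definition permmod_act (n : nat) (l : seq nat) (s : 'S_n) (v : permmod n l) :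
    permmod n l := [ffun T => v (tabloid_act (s^-1)%g T)].

Lemma permmod_act1 (n : nat) (l : seq nat) (v : permmod n l) :
  permmod_act 1%g v = v.
Proof.
apply/ffunP => T; rewrite ffunE; congr (v _).
by apply/val_inj/ffunP => x; rewrite /= ffunE invg1 perm1.
Qed.

Lemma permmod_actM (n : nat) (l : seq nat) (s s' : 'S_n) (v : permmod n l) :
  permmod_act (s * s')%g v = permmod_act s (permmod_act s' v).
Proof.
apply/ffunP => T; rewrite !ffunE; congr (v _).
by apply/val_inj/ffunP => x; rewrite /= !ffunE invMg permM.
Qed.

Definition tabloid_basis (n : nat) (l : seq nat) (T : tabloid n l) :
    permmod n l := [ffun T' => (T' == T)%:R].

Lemma permmod_act_basis (n : nat) (l : seq nat) (s : 'S_n) (T : tabloid n l) :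
  permmod_act s (tabloid_basis T) = tabloid_basis (tabloid_act s T).
Proof.
apply/ffunP => T'; rewrite !ffunE; congr (_%:R); congr nat_of_bool.
apply/eqP/eqP => [<-|->]; apply/val_inj/ffunP => x; rewrite /= !ffunE.
  by rewrite permK.
by rewrite permKV.
Qed.

Definition column_stabilizer (n : nat) (l : seq nat) (t : tableau n l) :
    {set 'S_n} := [set s : 'S_n | [forall x, (val t (s x)).2 == (val t x).2]]%SET.

Definition polytabloid (n : nat) (l : seq nat) (t : tableau n l) : permmod n l :=
  \sum_(s in column_stabilizer t)
    tabloid_basis (tabloid_act s (tabloid_of t)) *~ (-1) ^+ odd_perm s.

Definition specht (n : nat) (l : seq nat) : set (permmod n l) :=
  [set v | exists c : tableau n l -> int, v = \sum_t polytabloid t *~ c t].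

(* Second cohomology of a finite group with coefficients in the submodule S of
   V, by inhomogeneous cochains; elements of H2 are cosets of coboundaries. *)
Definition cocycle2 (gT : finGroupType) (V : zmodType) (act : gT -> V -> V)
    (S : set V) : set (gT -> gT -> V) :=
  [set f | (forall g h, S (f g h)) /\
           (forall g h k, act g (f h k) - f (g * h)%g k
                          + f g (h * k)%g - f g h = 0)].

Definition coboundary2 (gT : finGroupType) (V : zmodType) (act : gT -> V -> V)
    (S : set V) : set (gT -> gT -> V) :=
  [set f | exists2 c : gT -> V, (forall g, S (c g)) &
           (forall g h, f g h = act g (c h) - c (g * h)%g + c g)].

Definition H2 (gT : finGroupType) (V : zmodType) (act : gT -> V -> V)
    (S : set V) : set (set (gT -> gT -> V)) :=
  [set C | exists2 f, cocycle2 act S f &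
           C = [set f' | coboundary2 act S (fun g h => f' g h - f g h)]].

(* False for infinite A; the second cohomology of a
   finite group with coefficients in a finitely generated module is finite. *)
Definition dvd_card (T : Type) (p : nat) (A : set T) : Prop :=
  exists2 N : nat, (A #= `I_N)%card & (p %| N)%N.

Definition C2 (p : nat) : set (seq nat) :=
  [set l | exists2 n : nat, is_partition n l &
           dvd_card p (H2 (@permmod_act n l) (@specht n l))].

(* incr_nth l i adds a node at the end of row i; that the result is again a
   partition follows from membership of mu in C2 p. *)
Definition arrow (p : nat) (l mu : seq nat) : Prop :=
  [/\ C2 p l, C2 p mu & exists i : nat, mu = incr_nth l i].

Definition is_path (p : nat) (P : nat -> seq nat) : Prop :=
  [/\ injective P,
      forall i, arrow p (P i) (P i.+1) &
      forall l, ~ arrow p l (P 0%N)].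

(* Main.v *)
Require Import Defs.
From HB Require Import structures.
From mathcomp Require Import all_boot all_order all_algebra all_fingroup.
From mathcomp Require Import cyclic pgroup.
From mathcomp Require Import boolp classical_sets functions cardinality.
From mathcomp Require Import zify ring.

(** The path is
    (3m-2,1^2), (3m-2,1^3), and then alternately (a,2^k,1^3) and (a,2^k,1^4) for
    k = 0, 1, 2, ..., where a = 3m-1.

    Why these vertices are in the graph. Let M be the permutation module on the
    tabloids of shape lambda and S its Specht submodule. For a function F on
    tabloids, [raise j F] is the function on the tabloids of the shape obtained
    by moving a node from row j+1 up to row j: it sums F over all ways of pushing
    one entry of row j back down to row j+1. When every row after the first has
    length at most 2, S is exactly the common kernel of these maps, and the same
    holds modulo any modulus for which 2 can be cancelled ([kernel_span],
    [specht_mod], [spechtP]). This is James' kernel intersection theorem; it is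
    proved by branching on the row of one entry, and it shows that S is pure in M.

    Now let w in M be such that [raise j w] is a constant y_j modulo 3 for every
    j. Then g w - w lies in S + 3M for all g; writing g w - w = s_g + 3 u_g, the
    coboundary of u is a 2-cocycle with values in S, and 3 times it is the
    coboundary of - s. The constant function 1 has y_j = lambda_j + 1 and gives
    the zero class. A w whose y is not proportional to (lambda_j + 1) gives a
    class of order 3 ([specht_H2_nontrivial]), because a trivialization of the
    cocycle would make w constant modulo 3 up to an element of S tensored with
    the rationals. Conversely, every class of order 3 arises from some w, since
    the first cohomology of M/3 vanishes; so if y is always proportional to
    (lambda_j + 1), then there is no 3-torsion ([specht_H2_trivial]).

    Where w comes from. As a and 2 are both -1 modulo 3, the constant 1 is in the
    kernel modulo 3 for (a,2^k,1), that is, it lifts to the Specht module. By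
    branching it is the restriction of some W in the Specht module of
    (a,2^k,1^2) to the tabloids having a distinguished entry in the bottom row.
    Restricting W instead to the tabloids that have this entry in the last row of
    length greater than 1 gives a w with y_j = 1 in that row and y_j = 0
    elsewhere ([sym3_class]); this settles (3m-2,1^2) and (a,2^k,1^3). Removing
    one more entry in the same way settles (3m-2,1^3) and (a,2^k,1^4)
    ([sym4_class]).

    The start vertex has no predecessor: only (3m-2,1) and (3m-3,1^2) come into
    question, and for them y is forced to be proportional to (lambda_j + 1)
    ([not_C2_two_rows], [not_C2_hook]). *)

Set Implicit Arguments.
Unset Strict Implicit.
Unset Printing Implicit Defensive.

Import GRing.Theory.
Local Open Scope ring_scope.

(** * Words and raising operators *)

(** A tabloid is recorded by the word listing the row of each of its entries,
    and a shape by the function giving the length of each row. Words grow at the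
    head, so that branching on one entry is the case analysis on [i :: T]. *)
Definition content (L : nat -> nat) (T : seq nat) : Prop :=
  forall i, count_mem i T = L i.

(** The content of a word for the shape L with one node moved from row j+1 to
    row j, written additively so that no truncated subtraction occurs. *)
Definition raised (j : nat) (L : nat -> nat) (T : seq nat) : Prop :=
  forall i, (count_mem i T + (i == j.+1) = L i + (i == j))%N.

Definition raise (j : nat) (F : seq nat -> int) (T : seq nat) : int :=
  \sum_(x < size T | nth 0%N T x == j) F (set_nth 0%N T x j.+1).

Lemma dvdz_addl (N a b : int) : (N %| a)%Z -> (N %| a + b)%Z -> (N %| b)%Z.
Proof. by move=> Na Nab; rewrite -(addKr a b) addrC rpredB. Qed.

(** Branching formula: the first letter is either the one that is pushed down or
    a spectator. All inductions on the number of letters rest on it. *)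
Lemma raise_cons j F i T :
  raise j F (i :: T) =
  (if i == j then F (j.+1 :: T) else 0) + raise j (fun T => F (i :: T)) T.
Proof.
rewrite /raise big_mkcond big_ord_recl /=; congr (_ + _).
by rewrite [RHS]big_mkcond; apply: eq_bigr => x _.
Qed.

Lemma raiseD j F G T : raise j (fun T => F T + G T) T = raise j F T + raise j G T.
Proof. by rewrite /raise big_split. Qed.

Lemma raiseB j F G T : raise j (fun T => F T - G T) T = raise j F T - raise j G T.
Proof. by rewrite /raise sumrB. Qed.

Lemma raiseZ j a F T : raise j (fun T => a * F T) T = a * raise j F T.
Proof. by rewrite /raise mulr_sumr. Qed.

Lemma raise_sum j (I : Type) (c : seq I) (F : I -> seq nat -> int) T :
  raise j (fun T => \sum_(p <- c) F p T) T = \sum_(p <- c) raise j (F p) T.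
Proof. by rewrite /raise exchange_big. Qed.

Lemma raise1 j a T : raise j (fun=> a) T = a * (count_mem j T)%:R.
Proof.
elim: T => [|i T IH]; first by rewrite /raise big_ord0 mulr0.
by rewrite raise_cons IH /= natrD mulrDr; case: eqP; rewrite ?mulr1 ?mulr0.
Qed.

Lemma count_mem_set_nth (i v x : nat) T : (x < size T)%N ->
  (count_mem i (set_nth 0%N T x v) + (nth 0%N T x == i)
   = count_mem i T + (v == i))%N.
Proof.
elim: T x => [|u T IH] [|x] //= lt_x; first by rewrite addnC addnA addnAC.
by rewrite -!addnA IH.
Qed.

Lemma content_set_nth j L T (x : nat) : (x < size T)%N -> nth 0%N T x = j ->
  raised j L T -> content L (set_nth 0%N T x j.+1).
Proof.
move=> lt_x Tx hT i; have := count_mem_set_nth i j.+1 lt_x; have := hT i.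
by rewrite Tx (eq_sym i j) (eq_sym i j.+1); lia.
Qed.

Lemma raised_set_nth j L T (x : nat) : (x < size T)%N -> nth 0%N T x = j.+1 ->
  content L T -> raised j L (set_nth 0%N T x j).
Proof.
move=> lt_x Tx hT i; have := count_mem_set_nth i j lt_x; have := hT i.
by rewrite Tx (eq_sym i j) (eq_sym i j.+1); lia.
Qed.

Lemma eq_raise_mod (N : int) j L F G T : raised j L T ->
  (forall T, content L T -> (N %| F T - G T)%Z) ->
  (N %| raise j F T - raise j G T)%Z.
Proof.
move=> hT hFG; rewrite -raiseB; apply: rpred_sum => x /eqP Tx.
exact/hFG/(content_set_nth _ Tx hT).
Qed.

(** * Polytabloids as determinants *)
Definition polycoef_mx (t : seq (nat * nat)) (T : seq nat) : 'M[int]_(size t) :=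
  \matrix_(x, y) (((nth (0, 0)%N t x).2 == (nth (0, 0)%N t y).2)
                  && (nth 0%N T x == (nth (0, 0)%N t y).1))%:R.

(** The coefficient at the word T of the polytabloid of a tableau t, given by the
    list of the nodes of its entries. Expanding the determinant gives the signed
    sum over the column-preserving permutations that carry the rows of t to T;
    see [polytabloid_polycoef]. *)
Definition polycoef t T : int := \det (polycoef_mx t T).

Definition filling (L : nat -> nat) (t : seq (nat * nat)) : Prop :=
  uniq t /\ forall p, (p \in t) = (p.2 < L p.1)%N.

(** The left-hand side is the derivative of the determinant along the tangent
    vector A Phi at A, which is tr(Phi) det(A). *)
Lemma derivation_det0 (n : nat) (A Phi : 'M[int]_n) :
  \tr Phi = 0 ->
  \sum_x \sum_y (A *m Phi) x y * cofactor A x y = 0.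
Proof.
move=> tr0; transitivity (\tr (A *m Phi *m \adj A)).
  by apply: eq_bigr => x _; rewrite mxE; apply: eq_bigr => y _; rewrite [\adj A _ _]mxE.
by rewrite mxtrace_mulC mulmxA mul_adj_mx mul_scalar_mx mxtraceZ tr0 mulr0.
Qed.

(** Pushing an entry from row j to row j+1 replaces a row of the determinant by
    its image under the linear map Phi that shifts the node (j,c) to (j+1,c).
    So the sum over all entries is the derivation of the determinant along Phi,
    and Phi is off-diagonal, hence traceless. *)
Lemma raise_polycoef j L t T : (L j.+1 <= L j)%N -> filling L t -> size T = size t ->
  raise j (polycoef t) T = 0.
Proof.
move=> leL [t_uniq t_mem] sizeT.
pose c (x : nat) := (nth (0, 0)%N t x).2; pose r (x : nat) := (nth (0, 0)%N t x).1.
pose Phi : 'M[int]_(size t) :=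
  \matrix_(y, z) ([&& r y == j, r z == j.+1 & c y == c z])%:R.
have AP (x z : 'I_(size t)) : (polycoef_mx t T *m Phi) x z =
    ([&& nth 0%N T x == j, r z == j.+1 & c x == c z])%:R.
  rewrite mxE; case: (boolP [&& _, _ & _]) => [/and3P[/eqP Tx /eqP rz /eqP cxz]|h].
    have jc : ((j, c x) \in t).
      have : (r z, c z) \in t by rewrite -surjective_pairing mem_nth.
      by rewrite !t_mem /= rz cxz => /leq_trans; apply.
    have lt_y : (index (j, c x) t < size t)%N by rewrite index_mem.
    rewrite (bigD1 (Ordinal lt_y)) //= big1 => [|y ne_y].
      have [rE cE] : r (index (j, c x) t) = j /\ c (index (j, c x) t) = c x.
        by split; [rewrite /r (nth_index _ jc) | rewrite [LHS]/c (nth_index _ jc)].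
      by rewrite !mxE /= -/(c x) -/(c _) -/(r _) rE cE Tx rz cxz !eqxx mulr1 addr0.
    rewrite !mxE; apply/eqP; rewrite mulf_eq0 -/(c x) -/(c y) -/(r y) -/(r z) -/(c z) Tx.
    case: (c x =P c y) => //= cxy; case: (j =P r y) => //= ryj; case/negP: ne_y.
    apply/eqP/val_inj => /=; rewrite cxy ryj /c /r -surjective_pairing index_uniq //.
  apply: big1 => y _; rewrite !mxE -/(c x) -/(c y) -/(r y).
  case: (boolP (_ && _)) => [/andP[/eqP cxy /eqP Txy]|]; last by rewrite mul0r.
  by move: h; rewrite cxy Txy => /negbTE ->; rewrite mulr0.
have trPhi : \tr Phi = 0.
  apply: big1 => y _; rewrite !mxE.
  by case: eqP => //= ->; rewrite (ltn_eqF (ltnSn j)).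
rewrite -[RHS](derivation_det0 (polycoef_mx t T) trPhi).
rewrite /raise sizeT big_mkcond; apply: eq_bigr => x _.
case: eqP => [Tx|/eqP neTx]; last first.
  by rewrite big1 // => y _; rewrite AP (negbTE neTx) mul0r.
rewrite /polycoef (expand_det_row _ x); apply: eq_bigr => y _; congr (_ * _).
  by rewrite AP mxE nth_set_nth /= Tx eqxx eq_refl andbC (eq_sym j.+1).
rewrite /cofactor; congr (_ * \det _); apply/matrixP => x' y'.
by rewrite !mxE nth_set_nth /= ifN_eqC ?neq_bump.
Qed.

(** Column permutations never take an entry below the lowest node of its column;
    here p is that node, so the first row of the determinant vanishes. *)
Lemma polycoef_cons_below (p : nat * nat) (t : seq (nat * nat)) i T :
  (forall q, q \in t -> q.2 = p.2 -> (q.1 < i)%N) -> (p.1 < i)%N ->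
  polycoef (p :: t) (i :: T) = 0.
Proof.
move=> ht hp; rewrite /polycoef (expand_det_row _ ord0) big1 // => y _.
rewrite mxE /=; case: eqP => /= [py|]; last by rewrite mul0r.
have mem_y : nth (0, 0)%N (p :: t) y \in p :: t by rewrite mem_nth.
case: eqP => [iy|]; last by rewrite mul0r.
move: mem_y; rewrite inE => /orP[/eqP eq_p|/ht]; first by rewrite iy eq_p ltnn in hp.
by rewrite -py -iy ltnn => /(_ erefl).
Qed.

(** The first entry can reach the row of p only by staying in place: the first
    row of the determinant is a unit vector. *)
Lemma polycoef_cons_same (p : nat * nat) (t : seq (nat * nat)) T : p \notin t ->
  polycoef (p :: t) (p.1 :: T) = polycoef t T.
Proof.
move=> p_notin; rewrite /polycoef (expand_det_row _ ord0) (bigD1 ord0) //= big1 => [|y ne_y].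
  rewrite mxE /= !eqxx mul1r addr0 /cofactor addn0 expr0 mul1r; congr (\det _).
  by apply/matrixP => x y; rewrite !mxE.
rewrite mxE; case: (unliftP ord0 y) ne_y => [y' ->|-> /eqP//] _ /=.
rewrite andbC -xpair_eqE -!surjective_pairing.
case: eqP => [eq_p|]; last by rewrite mul0r.
by case/negP: p_notin; rewrite eq_p mem_nth //; exact: (ltn_ord y').
Qed.

(** * The kernel intersection theorem *)

(** Partitions whose rows, except perhaps the first, have length at most 2. For
    these the divided powers of the raising operators follow from the operators
    themselves once 2 can be cancelled, and equal rows are easy to treat. *)
Definition narrow (L : nat -> nat) : Prop :=
  forall i, (L i.+1 <= L i)%N /\ (L i.+1 <= 2)%N.

Definition remove_node (r : nat) (L : nat -> nat) : nat -> nat :=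
  fun i => (L i - (i == r))%N.

Definition combination (c : seq (int * seq (nat * nat))) (T : seq nat) : int :=
  \sum_(p <- c) p.1 * polycoef p.2 T.

Definition fillings L (c : seq (int * seq (nat * nat))) : Prop :=
  forall p, p \in c -> filling L p.2.

Lemma narrow_le L i j : narrow L -> (i <= j)%N -> (L j <= L i)%N.
Proof.
move=> yL /subnK <-; elim: (j - i)%N => // d IH.
by apply: leq_trans IH; case: (yL (d + i)%N).
Qed.

Lemma content_behead L r T : content L (r :: T) ->
  (0 < L r)%N /\ content (remove_node r L) T.
Proof.
move=> hT; split; first by rewrite -hT /= eqxx.
by move=> i; rewrite /remove_node -hT /= (eq_sym r); case: eqP => /=; lia.
Qed.

Lemma content_cons L r T : (0 < L r)%N -> content (remove_node r L) T ->
  content L (r :: T).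
Proof.
move=> L_gt0 hT i; rewrite /= hT /remove_node (eq_sym r).
by case: eqP => [->|] /=; lia.
Qed.

Lemma raised_cons L r j T : (0 < L r)%N -> raised j (remove_node r L) T ->
  raised j L (r :: T).
Proof.
move=> L_gt0 hT i; have := hT i; rewrite /= /remove_node (eq_sym r).
by case: (i =P r) => [->|_] /=; lia.
Qed.

Lemma filling_rows L t i : filling L t -> count_mem i (unzip1 t) = L i.
Proof.
move=> [t_uniq t_mem]; rewrite count_map -size_filter.
have eq_t : perm_eq [seq p <- t | p.1 == i] [seq (i, c) | c <- iota 0 (L i)].
  apply: uniq_perm; first exact: filter_uniq.
    by rewrite map_inj_uniq ?iota_uniq // => x y [].
  move=> [i' c]; rewrite mem_filter t_mem /=.
  apply/andP/mapP => [[/eqP -> lt_c]|[c']]; first by exists c; rewrite ?mem_iota.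
  by rewrite mem_iota => /= lt_c [-> ->].
by rewrite (perm_size eq_t) size_map size_iota.
Qed.

Lemma count_mem_perm (s1 s2 : seq nat) :
  (forall i, count_mem i s1 = count_mem i s2) -> perm_eq s1 s2.
Proof. by move=> h; apply/allP => x _ /=; apply/eqP. Qed.

Lemma size_raised L t j T : filling L t -> raised j L T -> size T = size t.
Proof.
move=> fill_t hT; have /perm_size : perm_eq (j.+1 :: T) (j :: unzip1 t).
  apply: count_mem_perm => i; have := hT i.
  rewrite [count_mem i (j :: _)]/= (filling_rows i fill_t) /= (eq_sym i) (eq_sym i j).
  lia.
by rewrite /= size_map => -[].
Qed.

Lemma raise_comb j L c T : narrow L -> fillings L c -> raised j L T ->
  raise j (combination c) T = 0.
Proof.
move=> yL fill_c hT; rewrite raise_sum big_seq big1 // => p /fill_c fill_p.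
rewrite raiseZ (raise_polycoef (L := L)) ?mulr0 //; first by case: (yL j).
exact: size_raised fill_p hT.
Qed.

Lemma filling_cons L r t : narrow L -> (L r.+1 < L r)%N ->
  filling (remove_node r L) t -> filling L ((r, (L r).-1) :: t).
Proof.
move=> yL ltL [t_uniq t_mem]; split=> [|[i c]].
  by rewrite /= t_uniq t_mem /remove_node /= eqxx; lia.
rewrite inE t_mem xpair_eqE /remove_node /=.
by case: (i =P r) => [->|_] /=; rewrite ?subn0 //; lia.
Qed.

(** A standard way to branch: put the first entry at the node p of a tableau of
    the smaller shape. *)
Definition lift_comb (p : nat * nat) (c : seq (int * seq (nat * nat))) :=
  [seq (q.1, p :: q.2) | q <- c].

Lemma fillings_lift L r c : narrow L -> (L r.+1 < L r)%N ->
  fillings (remove_node r L) c -> fillings L (lift_comb (r, (L r).-1) c).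
Proof.
by move=> yL ltL fill_c _ /mapP[q /fill_c fill_q ->]; exact: filling_cons.
Qed.

Lemma lift_comb_same L r c T : (0 < L r)%N -> fillings (remove_node r L) c ->
  combination (lift_comb (r, (L r).-1) c) (r :: T) = combination c T.
Proof.
move=> L_gt0 fill_c; rewrite /combination big_map !big_seq; apply: eq_bigr => q.
case/fill_c => _ q_mem; rewrite /= polycoef_cons_same // q_mem /remove_node /= eqxx; lia.
Qed.

Lemma lift_comb_below L r c i T : narrow L -> (L r.+1 < L r)%N -> (r < i)%N ->
  fillings (remove_node r L) c -> combination (lift_comb (r, (L r).-1) c) (i :: T) = 0.
Proof.
move=> yL ltL lt_ri fill_c; rewrite /combination big_map big_seq big1 // => q /fill_c[_ q_mem].
rewrite /= polycoef_cons_below ?mulr0 // => -[i' c'] /=; rewrite q_mem /remove_node /= => + eq_c.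
rewrite {}eq_c => lt_c; case: (ltnP r i') => [lt_ri'|]; last by lia.
by have := narrow_le yL lt_ri'; move: lt_c; case: eqP => /=; lia.
Qed.

Definition kernel (N : int) L F : Prop :=
  forall j T, raised j L T -> (N %| raise j F T)%Z.

Lemma kernelB N L F G : kernel N L F -> kernel N L G ->
  kernel N L (fun T => F T - G T).
Proof. by move=> hF hG j T hT; rewrite raiseB rpredB ?hF ?hG. Qed.

Lemma kernel_comb N L c : narrow L -> fillings L c -> kernel N L (combination c).
Proof. by move=> yL fill_c j T hT; rewrite (raise_comb yL fill_c hT) dvdz0. Qed.

(** If F vanishes when the first entry lies in row r+1, then its restriction to
    the first entry in row r is in the kernel for the smaller shape: the only
    extra term in the branching formula is the value with that entry pushed down
    to row r+1. *)
Lemma kernel_behead N L r F : (0 < L r)%N -> kernel N L F ->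
  (forall T, content L (r.+1 :: T) -> (N %| F (r.+1 :: T))%Z) ->
  kernel N (remove_node r L) (fun T => F (r :: T)).
Proof.
move=> L_gt0 hF F0 j T hT; have hrT := raised_cons L_gt0 hT.
have := hF j (r :: T) hrT; rewrite raise_cons.
case: eqP => [eq_j|]; last by rewrite add0r.
rewrite -eq_j in hrT *; apply: dvdz_addl; apply: F0.
exact: (content_set_nth (x := 0%N) _ _ hrT).
Qed.

Lemma nth_count0 j T (z : nat) : count_mem j T = 0%N -> (z < size T)%N -> nth 0%N T z <> j.
Proof.
move=> /eqP; rewrite eqn0Ngt -has_count => /hasPn hT lt_z Tz.
by have /hT := mem_nth 0%N lt_z; rewrite /= Tz eqxx.
Qed.

Lemma raise_single j F T (x : nat) : (x < size T)%N -> nth 0%N T x = j ->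
  count_mem j T = 1%N -> raise j F T = F (set_nth 0%N T x j.+1).
Proof.
move=> lt_x Tx cT; rewrite /raise (bigD1 (Ordinal lt_x)) ?Tx //= big1 ?addr0 // => z.
case/andP=> /eqP Tz ne_z; exfalso.
have := count_mem_set_nth j j.+1 lt_x; rewrite cT Tx eqxx gtn_eqF // => -[]; rewrite addn1 => -[c0].
apply: (nth_count0 c0 (z := z)); first by rewrite size_set_nth leq_max ltn_ord orbT.
by rewrite nth_set_nth /= ifN.
Qed.

Lemma raise_pair j F T (x y : nat) : (x < size T)%N -> (y < size T)%N -> x != y ->
  nth 0%N T x = j -> nth 0%N T y = j -> count_mem j T = 2%N ->
  raise j F T = F (set_nth 0%N T x j.+1) + F (set_nth 0%N T y j.+1).
Proof.
move=> lt_x lt_y ne_xy Tx Ty cT.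
rewrite /raise (bigD1 (Ordinal lt_x)) ?Tx //= (bigD1 (Ordinal lt_y)) /=; last first.
  by rewrite Ty -val_eqE /= eqxx eq_sym.
rewrite big1 ?addr0 // => z /andP[/andP[/eqP Tz ne_z] ne_zy]; exfalso.
have := count_mem_set_nth j j.+1 lt_x; rewrite cT Tx eqxx gtn_eqF // addn1 addn0 => -[c1].
have lt_y' : (y < size (set_nth 0%N T x j.+1))%N by rewrite size_set_nth leq_max lt_y orbT.
have := count_mem_set_nth j j.+1 lt_y'; rewrite c1 nth_set_nth /= ifN 1?eq_sym // Ty eqxx gtn_eqF //.
rewrite addn1 => -[c0].
apply: (nth_count0 c0 (z := z)); first by rewrite !size_set_nth !leq_max ltn_ord !orbT.
by rewrite nth_set_nth /= ifN // nth_set_nth /= ifN.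
Qed.

Lemma set_nth_same T (x v : nat) : (x < size T)%N -> nth 0%N T x = v ->
  set_nth 0%N T x v = T.
Proof.
move=> lt_x <-; apply: (@eq_from_nth _ 0%N) => [|z _].
  by rewrite size_set_nth (maxn_idPr lt_x).
by rewrite nth_set_nth /=; case: eqP => [->|].
Qed.

(** When row r is one node shorter than row r+1, raising from row r+1 to row r is
    injective. For the lengths 0 and 1 it just moves the single entry. *)
Lemma kernel_eq_rows1 N L r F T : L r = 0%N -> L r.+1 = 1%N ->
  kernel N L F -> content L T -> (N %| F T)%Z.
Proof.
move=> Lr Lr1 hF hT.
have lt_x : (index r.+1 T < size T)%N by rewrite index_mem -has_pred1 has_count hT Lr1.
set x := index r.+1 T in lt_x.
have Tx : nth 0%N T x = r.+1 by rewrite nth_index // -index_mem.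
have hT' := raised_set_nth lt_x Tx hT.
have lt_x' : (x < size (set_nth 0%N T x r))%N by rewrite size_set_nth leq_max lt_x orbT.
have := hF _ _ hT'; rewrite (raise_single _ lt_x') ?nth_set_nth /= ?eqxx //; last first.
  by have := hT' r; rewrite Lr eqxx ltn_eqF //= addn0 add0n.
by rewrite set_set_nth eqxx set_nth_same.
Qed.

Lemma content_nth L i T : content L T -> (0 < L i)%N ->
  exists2 x : nat, (x < size T)%N & nth 0%N T x = i.
Proof.
move=> hT L_gt0; exists (index i T); last first.
  by rewrite nth_index // -has_pred1 has_count hT.
by rewrite index_mem -has_pred1 has_count hT.
Qed.

(** Raise an entry y from row r+1: then row r holds x and y, and the two ways of
    pushing one of them down are T and T with x and y exchanged. *)
Lemma kernel_swap N L r F T (x y : nat) : L r = 1%N -> (x < size T)%N -> (y < size T)%N ->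
  nth 0%N T x = r -> nth 0%N T y = r.+1 -> kernel N L F -> content L T ->
  (N %| F T + F (set_nth 0%N (set_nth 0%N T y r) x r.+1))%Z.
Proof.
move=> Lr lt_x lt_y Tx Ty hF hT; have hT' := raised_set_nth lt_y Ty hT.
have ne_xy : x != y by apply/eqP => eq_xy; move: Tx; rewrite eq_xy Ty; lia.
have := hF _ _ hT'; rewrite (raise_pair F (x := y) (y := x)).
- by rewrite set_set_nth eqxx set_nth_same.
- by rewrite size_set_nth leq_max lt_y orbT.
- by rewrite size_set_nth leq_max lt_x orbT.
- by rewrite eq_sym.
- by rewrite nth_set_nth /= eqxx.
- by rewrite nth_set_nth /= ifN.
- by have := hT' r; rewrite Lr eqxx ltn_eqF //= addn0.
Qed.

(** Three such exchanges lead back to T and change the sign of F an odd number of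
    times, so 2 F(T) vanishes. *)
Lemma kernel_eq_rows2 N L r F T :
  (forall z, (N %| z * 2)%Z -> (N %| z)%Z) ->
  L r = 1%N -> L r.+1 = 2%N -> kernel N L F -> content L T -> (N %| F T)%Z.
Proof.
move=> N2 Lr Lr1 hF hT.
have [a lt_a Ta] : exists2 x : nat, (x < size T)%N & nth 0%N T x = r.
  by apply: content_nth hT _; rewrite Lr.
have [b lt_b Tb] : exists2 x : nat, (x < size T)%N & nth 0%N T x = r.+1.
  by apply: content_nth hT _; rewrite Lr1.
have ne_ab : a != b by apply/eqP => eq_ab; move: Ta; rewrite eq_ab Tb; lia.
have sz (s : seq nat) (x y v : nat) : (x < size s)%N -> (x < size (set_nth 0%N s y v))%N.
  by move=> lt_x; rewrite size_set_nth leq_max lt_x orbT.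
have cT' := hT r.+1; rewrite Lr1 in cT'.
have [c lt_c [ne_cb Tc]] : exists2 c : nat, (c < size T)%N & c != b /\ nth 0%N T c = r.+1.
  have := raised_set_nth lt_b Tb hT r.+1; rewrite Lr1 eqxx gtn_eqF // addn1 addn0 => -[c1].
  have : has (pred1 r.+1) (set_nth 0%N T b r) by rewrite has_count c1.
  rewrite has_pred1 => /(nthP 0%N)[c]; rewrite size_set_nth (maxn_idPr lt_b) => lt_c.
  rewrite nth_set_nth /=; case: eqP => [_ eq_r|/eqP ne_cb Tc]; last by exists c.
  by move: eq_r => /eqP; rewrite ltn_eqF.
have ne_ac : a != c by apply/eqP => eq_ac; move: Ta; rewrite eq_ac Tc; lia.
have [ba ca bc] : [/\ (b == a) = false, (c == a) = false & (b == c) = false].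
  by split; rewrite eq_sym; apply/negbTE.
(* The entry of row r is a in T, b in T1 and c in T2, and a again after the third
   exchange. *)
pose T1 := set_nth 0%N (set_nth 0%N T b r) a r.+1.
pose T2 := set_nth 0%N (set_nth 0%N T1 c r) b r.+1.
have cont_swap s x y : content L s -> (x < size s)%N -> (y < size s)%N -> x != y ->
  nth 0%N s x = r -> nth 0%N s y = r.+1 -> content L (set_nth 0%N (set_nth 0%N s y r) x r.+1).
  move=> hs lt_x lt_y ne_xy sx sy; apply: content_set_nth (raised_set_nth lt_y sy hs); first exact: sz.
  by rewrite nth_set_nth /= ifN.
have T1b : nth 0%N T1 b = r by rewrite /T1 nth_set_nth /= ba nth_set_nth /= eqxx.
have T1c : nth 0%N T1 c = r.+1 by rewrite /T1 nth_set_nth /= ca nth_set_nth /= (negbTE ne_cb).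
have T2c : nth 0%N T2 c = r by rewrite /T2 nth_set_nth /= (negbTE ne_cb) nth_set_nth /= eqxx.
have T2a : nth 0%N T2 a = r.+1 
  by rewrite /T2 nth_set_nth /= (negbTE ne_ab) nth_set_nth /= (negbTE ne_ac) /T1 nth_set_nth /= eqxx.
have hT1 : content L T1 by exact: cont_swap.
have hT2 : content L T2 by apply: cont_swap => //; rewrite ?bc // !sz.
have eqT3 : set_nth 0%N (set_nth 0%N T2 a r) c r.+1 = T.
  apply: (@eq_from_nth _ 0%N) => [|z _]; first by rewrite !size_set_nth; lia.
  rewrite /T2 /T1; do 6! rewrite ?nth_set_nth /=.
  case: (z =P c) => [->|_]; first by rewrite Tc.
  case: (z =P a) => [->|_]; first by rewrite Ta.
  by case: (z =P b) => [->|_]; first by rewrite Tb.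
have s1 : (N %| F T + F T1)%Z := kernel_swap Lr lt_a lt_b Ta Tb hF hT.
have s2 : (N %| F T1 + F T2)%Z.
  by apply: (kernel_swap Lr (x := b) (y := c) _ _ T1b T1c hF hT1); rewrite !sz.
have s3 : (N %| F T2 + F T)%Z.
  rewrite -[in F T]eqT3.
  by apply: (kernel_swap Lr (x := c) (y := a) _ _ T2c T2a hF hT2); rewrite !sz.
apply: N2; have -> : F T * 2 = (F T + F T1) - (F T1 + F T2) + (F T2 + F T) by ring.
by rewrite rpredD ?rpredB.
Qed.

Lemma narrow_remove L r : narrow L -> (L r.+1 < L r)%N -> narrow (remove_node r L).
Proof.
move=> yL ltL i; rewrite /remove_node; have [leL le2] := yL i; have [leL1 _] := yL r.
by case: (i =P r) => [eq_ir|ne_ir]; case: (i.+1 =P r) => [eq_ir1|ne_ir1] /=; subst; lia.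
Qed.

Lemma span_empty (N : int) L F : narrow L -> L 0%N = 0%N ->
  exists2 c, fillings L c & forall T, content L T -> (N %| F T - combination c T)%Z.
Proof.
move=> yL L0; have Li i : L i = 0%N by have := narrow_le yL (leq0n i); rewrite L0; lia.
exists [:: (F [::], [::])] => [p|[|i T] hT].
- by rewrite inE => /eqP ->; split=> // q; rewrite Li ltn0.
- by rewrite /combination big_seq1 /polycoef det_mx00 mulr1 subrr dvdz0.
by have [] := content_behead hT; rewrite Li.
Qed.

Lemma size_content L k T : narrow L -> L k = 0%N -> content L T ->
  size T = (\sum_(i < k) L i)%N.
Proof.
move=> yL Lk hT; have lt_k : all (fun i => i < k)%N T.
  apply/allP => i Ti; rewrite ltnNge; apply: contraTN Ti => le_ki.
  have := narrow_le yL le_ki; rewrite Lk leqn0 => /eqP Li.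
  by rewrite -has_pred1 has_count hT Li.
rewrite -(eq_bigr _ (fun (i : 'I_k) _ => hT i)).
elim: T lt_k {hT} => [|u T IH] /=; first by rewrite big1.
case/andP=> lt_u /IH ->; rewrite [RHS]big_split /= -[LHS]add1n; congr (_ + _)%N.
rewrite (bigD1 (Ordinal lt_u)) //= eqxx big1 // => i.
by rewrite -val_eqE /= eq_sym => /negbTE ->.
Qed.

(** Induction on the number of letters. Going up from the bottom row, suppose
    that F vanishes whenever the first entry lies below row r. If row r is longer
    than row r+1, the restriction of F to the first entry in row r is in the
    kernel for the smaller shape, hence a combination of polytabloids; lifting
    these and subtracting clears row r without disturbing the rows below. If the
    two rows are equal, the restriction already vanishes. *)
Lemma kernel_span_bounded (N : int) n L F k :
  (forall z, (N %| z * 2)%Z -> (N %| z)%Z) ->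
  narrow L -> L k = 0%N -> (forall T, content L T -> size T <= n)%N -> kernel N L F ->
  exists2 c, fillings L c & forall T, content L T -> (N %| F T - combination c T)%Z.
Proof.
move=> N2; elim: n L F => [|n IH] L F yL Lk szL hF; have [L0|L_gt0] := posnP (L 0%N).
1,3: exact: span_empty.
  exists [::] => // T hT; have := szL T hT; have := hT 0%N.
  by case: T {hT} => //= eq0; move: L_gt0; rewrite -eq0.
suff [c fill_c hc] : exists2 c, fillings L c &
    forall i T, (k <= i + k)%N -> content L (i :: T) -> (N %| F (i :: T) - combination c (i :: T))%Z.
  exists c => // -[|i T] hT; first by have := hT 0%N; rewrite /=; lia.
  by apply: hc => //; lia.
(* Rows k and below are empty; d is the number of rows above k already cleared. *)
elim: {2}k => [|d [c fill_c hc]].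
  exists [::] => // i T; rewrite addn0 => le_ki hT.
  have := narrow_le yL le_ki; rewrite Lk leqn0 => /eqP Li.
  by have [] := content_behead hT; rewrite Li.
have [le_kd|lt_dk] := leqP k d.
  by exists c => // i T _ hT; apply: hc => //; lia.
pose r := (k - d.+1)%N; pose H T := F T - combination c T.
have hH : kernel N L H by apply: kernelB => //; exact: kernel_comb.
have H0 i T : (r < i)%N -> content L (i :: T) -> (N %| H (i :: T))%Z.
  by move=> lt_ri hT; apply: hc => //; lia.
have [Lr0|Lr_gt0] := posnP (L r).
  exists c => // i T le_i hT; case: (ltngtP r i) => [lt_ri||eq_ri].
  - exact: H0.
  - by lia.
  by subst i; have [] := content_behead hT; rewrite Lr0.
have hHr : kernel N (remove_node r L) (fun T => H (r :: T)).
  by apply: kernel_behead => // T; exact: H0.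
have [ltL|geL] := ltnP (L r.+1) (L r).
  have [||c' fill_c' hc'] := IH (remove_node r L) _ (narrow_remove yL ltL) _ _ hHr.
  - by rewrite /remove_node Lk.
  - by move=> T /(content_cons Lr_gt0)/szL.
  exists (c ++ lift_comb (r, (L r).-1) c').
    by move=> p; rewrite mem_cat => /orP[/fill_c|/(fillings_lift yL ltL fill_c')].
  move=> i T le_i hT; rewrite /combination big_cat -!/(combination _ _) opprD addrA -/(H _).
  case: (ltngtP r i) => [lt_ri||eq_ri].
  - by rewrite lift_comb_below // subr0 H0.
  - by lia.
  by subst i; rewrite lift_comb_same // hc' //; case: (content_behead hT).
have [leL le2] := yL r.
exists c => // i T le_i hT; case: (ltngtP r i) => [lt_ri||eq_ri].
- exact: H0.
- by lia.
subst i; have [_ hT'] := content_behead hT.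
have: L r = 1%N \/ L r = 2%N by lia.
case=> Lr.
  by apply: (kernel_eq_rows1 (r := r)) hHr hT'; rewrite /remove_node; lia.
by apply: (kernel_eq_rows2 (r := r) N2) hHr hT'; rewrite /remove_node; lia.
Qed.

(** James' kernel intersection theorem for narrow shapes, modulo N; the modulus 0
    gives the integral statement. *)
Theorem kernel_span (N : int) L F k :
  (forall z, (N %| z * 2)%Z -> (N %| z)%Z) ->
  narrow L -> L k = 0%N -> kernel N L F ->
  exists2 c, fillings L c & forall T, content L T -> (N %| F T - combination c T)%Z.
Proof.
move=> N2 yL Lk hF; apply: (kernel_span_bounded N2 yL Lk _ hF) => T hT.
by rewrite (size_content yL Lk hT).
Qed.

Lemma two_cancel0 z : (0 %| z * 2)%Z -> (0 %| z)%Z.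
Proof. by rewrite !dvd0z mulf_eq0 orbF. Qed.

Lemma two_cancel3 z : (3 %| z * 2)%Z -> (3 %| z)%Z.
Proof. by rewrite Gauss_dvdzl. Qed.

(** * Functions with constant raisings *)

(** The restriction map of the branching rule is onto: every element of the
    kernel for the smaller shape is the restriction of an integral Specht
    element. This is the step that makes the explicit classes possible. *)
Lemma lift_kernel N L l F k : (forall z, (N %| z * 2)%Z -> (N %| z)%Z) ->
  narrow L -> L k = 0%N -> (L l.+1 < L l)%N -> kernel N (remove_node l L) F ->
  exists2 W, (forall N', kernel N' L W) &
    forall T, content (remove_node l L) T -> (N %| F T - W (l :: T))%Z.
Proof.
move=> N2 yL Lk ltL hF; have L_gt0 : (0 < L l)%N by lia.
have [|c fill_c hc] := kernel_span (k := k) N2 (narrow_remove yL ltL) _ hF.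
  by rewrite /remove_node Lk.
exists (combination (lift_comb (l, (L l).-1) c)) => [N'|T hT].
  by apply: kernel_comb => //; exact: fillings_lift.
by rewrite lift_comb_same // hc.
Qed.

Definition raises (L : nat -> nat) (y : nat -> int) (F : seq nat -> int) : Prop :=
  forall j T, raised j L T -> (3 %| raise j F T - y j)%Z.

Lemma raises_kernel L F : kernel 3 L F -> raises L (fun=> 0) F.
Proof. by move=> hF j T hT; rewrite subr0 hF. Qed.

Lemma raised_gt0 L j T : raised j L T ->
  (0 < L j.+1)%N /\ count_mem j T = (L j).+1.
Proof.
move=> hT; have := hT j.+1; have := hT j.
by rewrite !eqxx (ltn_eqF (ltnSn j)) (gtn_eqF (ltnSn j)); lia.
Qed.

Lemma raised_succ L i T : (0 < L i)%N -> raised i (remove_node i L) T ->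
  content L (i.+1 :: T).
Proof.
move=> L_gt0 /(raised_cons L_gt0) hT.
exact: (content_set_nth (x := 0%N) _ _ hT).
Qed.

(** Restricting to the first entry in row i changes only the constant y_i, by the
    value taken when that entry is pushed down to row i+1. *)
Lemma raises_behead L y u i v : raises L y u -> (0 < L i)%N ->
  (forall T, content L (i.+1 :: T) -> (3 %| u (i.+1 :: T) - v)%Z) ->
  raises (remove_node i L) (fun j => y j - (j == i)%:R * v) (fun T => u (i :: T)).
Proof.
move=> hu L_gt0 hv j T hT; have := hu j (i :: T) (raised_cons L_gt0 hT).
rewrite raise_cons (eq_sym i); case: eqP hT => [-> hT|_ _]; last by rewrite add0r mul0r subr0.
have hvT := hv _ (raised_succ L_gt0 hT); move=> h.
apply: dvdz_addl hvT _; rewrite mul1r; move: h; congr (_ %| _)%Z; ring.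
Qed.

(** Between two rows of length 1 the branching formula has a single spectator
    term, so it determines the values with the first entry in row i. *)
Lemma raises_single L y u i v : raises L y u -> L i = 1%N -> L i.+1 = 1%N ->
  (forall T, content L (i.+1 :: T) -> (3 %| u (i.+1 :: T) - v)%Z) ->
  forall T, content L (i :: T) -> (3 %| u (i :: T) - (y i - v))%Z.
Proof.
move=> hu Li Li1 hv T /content_behead[L_gt0 hT].
have hR := raises_behead hu L_gt0 hv.
have [|x lt_x Tx] := content_nth (i := i.+1) hT; first by rewrite /remove_node Li1; lia.
have hT' := raised_set_nth lt_x Tx hT.
have lt_x' : (x < size (set_nth 0%N T x i))%N by rewrite size_set_nth leq_max lt_x orbT.
have := hR i _ hT'; rewrite eqxx mul1r (raise_single _ lt_x') ?nth_set_nth /= ?eqxx //; last first.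
  by have [_ ->] := raised_gt0 hT'; rewrite /remove_node Li eqxx.
by rewrite set_set_nth eqxx set_nth_same.
Qed.

(** W has value 1 when the first entry is in the bottom row r+2, hence -1 when it
    is in row r+1; then [raises_behead] turns this -1 into the constant 1 for
    row r. *)
Lemma sym3_class L r k : narrow L -> L k = 0%N -> L r.+1 = 1%N -> L r.+2 = 1%N -> L r.+3 = 0%N ->
  (0 < L r)%N ->
  (forall j, (j <= r)%N -> (3 %| ((L j).+1%:R : int))%Z) ->
  exists F, raises (remove_node r L) (fun j => (j == r)%:R) F.
Proof.
move=> yL Lk L1 L2 L3 L_gt0 L_mod3.
have [||W hW hW1] := lift_kernel (l := r.+2) (F := fun=> 1) two_cancel3 yL Lk.
- by rewrite L2 L3.
- move=> j T hT; rewrite raise1 mul1r; have [+ ->] := raised_gt0 hT.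
  rewrite /remove_node; case: (leqP j r) => [le_jr _|lt_rj].
    rewrite (_ : (j == r.+2) = false) ?subn0; last by lia.
    exact: L_mod3.
  case: (ltngtP j r.+1) => [|lt_j|->]; [by lia| |by rewrite L2 eqxx].
  by have := narrow_le yL (lt_j : (r.+3 <= j.+1)%N); rewrite L3; lia.
have rW : raises L (fun=> 0) W by apply: raises_kernel.
have W2 T : content L (r.+2 :: T) -> (3 %| W (r.+2 :: T) - 1)%Z.
  by case/content_behead=> _ /hW1; rewrite -opprB rpredN.
have W1 := raises_single rW L1 L2 W2.
exists (fun T => W (r :: T)) => j T hT.
have := raises_behead rW L_gt0 W1 hT; congr (_ %| _)%Z; ring.
Qed.

(** Here y is (0,1,0) on the rows r, r+1, r+2. Adding the constant function 1,
    whose constants there are (0,2,2), and changing sign gives (0,0,1). Then the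
    restriction to the first entry in the bottom row r+3 is in the kernel, and
    subtracting a lift makes it vanish. From row r+3 upwards the values become
    0, 1, -1, and the last of these is what row r receives. *)
Lemma sym4_class L r k F : narrow L -> L k = 0%N ->
  L r.+1 = 1%N -> L r.+2 = 1%N -> L r.+3 = 1%N -> L r.+4 = 0%N -> (0 < L r)%N ->
  (forall j, (j <= r)%N -> (3 %| ((L j).+1%:R : int))%Z) ->
  raises L (fun j => (j == r.+1)%:R) F ->
  exists u, raises (remove_node r L) (fun j => (j == r)%:R + (j == r.+2)%:R) u.
Proof.
move=> yL Lk L1 L2 L3 L4 L_gt0 L_mod3 hF.
pose v T := - F T - 1.
have rv : raises L (fun j => (j == r.+2)%:R) v.
  move=> j T hT; have hFj := hF j T hT; have [L_gt0j cT] := raised_gt0 hT.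
  have -> : raise j v T = - raise j F T - (L j).+1%:R.
    by rewrite raiseB raise1 cT mul1r -[RHS]/(- _ - _) /raise sumrN.
  have : (3 %| ((L j).+1%:R + (j == r.+1)%:R + (j == r.+2)%:R : int))%Z.
    case: (ltngtP j r.+1) => [lt_jr|lt_rj|->].
    - by rewrite (_ : (j == r.+2) = false) ?addr0 ?L_mod3 //; lia.
    - have -> : j = r.+2; last by rewrite eqxx L2.
      have [//|lt_j] : j = r.+2 \/ (r.+3 < j.+1)%N by lia.
      by have := narrow_le yL lt_j; rewrite L4; lia.
    by rewrite L1 ltn_eqF.
  have -> : - raise j F T - (L j).+1%:R - (j == r.+2)%:R =
    - (raise j F T - (j == r.+1)%:R + ((L j).+1%:R + (j == r.+1)%:R + (j == r.+2)%:R)) by ring.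
  by move=> mod3; rewrite rpredN rpredD.
have [||W hW hW1] := lift_kernel (l := r.+3) (F := fun T => v (r.+3 :: T)) two_cancel3 yL Lk.
- by rewrite L3 L4.
- have L3_gt0 : (0 < L r.+3)%N by rewrite L3.
  have v4 T : content L (r.+4 :: T) -> (3 %| v (r.+4 :: T) - 0)%Z.
    by case/content_behead; rewrite L4.
  move=> j T hT; have := raises_behead rv L3_gt0 v4 hT; rewrite mulr0 subr0.
  have [L_gt0j _] := raised_gt0 hT; rewrite (_ : (j == r.+2) = false) ?subr0 //.
  by apply/eqP => eq_j; move: L_gt0j; rewrite eq_j /remove_node L3 eqxx.
pose u T := v T - W T.
have ru : raises L (fun j => (j == r.+2)%:R) u.
  by move=> j T hT; rewrite raiseB addrAC rpredB ?rv // hW.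
have u3 T : content L (r.+3 :: T) -> (3 %| u (r.+3 :: T) - 0)%Z.
  by case/content_behead=> _ /hW1; rewrite subr0.
have u2 := raises_single ru L2 L3 u3.
have u1 := raises_single ru L1 L2 u2.
exists (fun T => u (r :: T)) => j T hT.
have := raises_behead ru L_gt0 u1 hT; congr (_ %| _)%Z.
by rewrite eqxx (ltn_eqF (ltnSn r.+1)) mulr0n mulr1n; ring.
Qed.

(** * From words to tabloids *)
Definition weight (l : seq nat) : nat -> nat := fun i => nth 0%N l i.

Definition word (n : nat) (f : {ffun 'I_n -> 'I_n}) : seq nat :=
  [seq (f x : nat) | x <- enum 'I_n].

Definition word_act (n : nat) (s : 'S_n) (W : seq nat) : seq nat :=
  [seq nth 0%N W (s x) | x : 'I_n <- enum 'I_n].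

Lemma size_word n (f : {ffun 'I_n -> 'I_n}) : size (word f) = n.
Proof. by rewrite size_map size_enum_ord. Qed.

Lemma size_word_act n (s : 'S_n) W : size (word_act s W) = n.
Proof. by rewrite size_map size_enum_ord. Qed.

Lemma nth_word n (f : {ffun 'I_n -> 'I_n}) (x : 'I_n) : nth 0%N (word f) x = f x.
Proof. by rewrite (nth_map x) ?size_enum_ord // nth_ord_enum. Qed.

Lemma nth_word_act n (s : 'S_n) W (x : 'I_n) : nth 0%N (word_act s W) x = nth 0%N W (s x).
Proof. by rewrite (nth_map x) ?size_enum_ord // nth_ord_enum. Qed.

Lemma word_inj n : injective (@word n).
Proof.
by move=> f g eq_fg; apply/ffunP => x; apply/val_inj; rewrite /= -!nth_word eq_fg.
Qed.

Lemma eq_word n (V W : seq nat) : size V = n -> size W = n ->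
  (forall x : 'I_n, nth 0%N V x = nth 0%N W x) -> V = W.
Proof.
move=> szV szW eq_nth; apply: (@eq_from_nth _ 0%N) => [|x]; first by rewrite szV.
by rewrite szV => lt_x; exact: (eq_nth (Ordinal lt_x)).
Qed.

Lemma word_act_perm n (s : 'S_n) W : size W = n -> perm_eq (word_act s W) W.
Proof.
move=> szW; have sz : size W == n by rewrite szW.
apply/(@tuple_permP _ n _ (Tuple sz)); exists s.
by apply: eq_map => x /=; rewrite (tnth_nth 0%N).
Qed.

Lemma word_act_trans n V W : size W = n -> perm_eq V W ->
  exists s : 'S_n, V = word_act s W.
Proof.
move=> szW; have sz : size W == n by rewrite szW.
case/(@tuple_permP _ n _ (Tuple sz)) => s ->; exists s.
by apply: eq_map => x /=; rewrite (tnth_nth 0%N).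
Qed.

Lemma perm_raised L j V W : perm_eq V W -> raised j L V <-> raised j L W.
Proof. by move=> /seq.permP eq_VW; split=> h i; rewrite -h eq_VW. Qed.

Lemma raise_size n j F W : size W = n ->
  raise j F W = \sum_(x < n | nth 0%N W x == j) F (set_nth 0%N W x j.+1).
Proof. by move=> <-. Qed.

(** Raising operators commute with permuting the letters. *)
Lemma raise_word_act n (s : 'S_n) j F W : size W = n ->
  raise j (fun V => F (word_act s V)) W = raise j F (word_act s W).
Proof.
move=> szW; rewrite (raise_size _ _ szW) (raise_size _ _ (size_word_act s W)).
rewrite (reindex_inj (@perm_inj _ s)) /=.
apply: eq_big => [x|x _]; first by rewrite nth_word_act.
congr F; apply: (@eq_word n) => [||y]; first exact: size_word_act.
  by rewrite size_set_nth size_word_act (maxn_idPr (ltn_ord x)).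
rewrite nth_word_act !nth_set_nth /= nth_word_act.
by rewrite !(inj_eq val_inj) (inj_eq perm_inj).
Qed.

Section Bridge.

Variables (n : nat) (l : seq nat).
Hypothesis part_l : is_partition n l.

Let L := weight l.

Hypothesis yL : narrow L.

Lemma weight_size : L (size l) = 0%N.
Proof. by rewrite /L /weight nth_default. Qed.

Lemma sum_weight : (\sum_(i < size l) L i)%N = n.
Proof. by case/and3P: part_l => _ _ /eqP <-; rewrite sumnE (big_nth 0%N) big_mkord. Qed.

Lemma size_content_weight T : content L T -> size T = n.
Proof. by move=> hT; rewrite (size_content yL weight_size hT) sum_weight. Qed.

Lemma size_raised_weight j T : raised j L T -> size T = n.
Proof.
move=> hT; have [_ cT] := raised_gt0 hT.
have : (0 < count_mem j T)%N by rewrite cT.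
rewrite -has_count has_pred1 => /(nthP 0%N)[x lt_x Tx].
have := size_content_weight (content_set_nth lt_x Tx hT).
by rewrite size_set_nth (maxn_idPr lt_x).
Qed.

Lemma node_lt i c : (c < L i)%N -> (i < n)%N && (c < n)%N.
Proof.
move=> lt_c; have lt_i : (i < size l)%N.
  by rewrite ltnNge; apply: contraTN lt_c => le_i; rewrite /L /weight nth_default.
rewrite -sum_weight; apply/andP; split; last first.
  by apply: leq_trans lt_c _; rewrite (bigD1 (Ordinal lt_i)) //= leq_addr.
have -> : i = (\sum_(j < i) 1)%N by rewrite sum1_card card_ord.
rewrite (big_ord_widen_cond _ (fun=> true) (fun=> 1%N) (ltnW lt_i)) /=.
rewrite [X in (_ < X)%N](bigD1 (Ordinal lt_i)) //= -[X in (X < _)%N]add0n -addSn.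
apply: leq_add; first by rewrite (leq_ltn_trans _ lt_c).
rewrite big_mkcond [X in (_ <= X)%N]big_mkcond; apply: leq_sum => j _ /=.
case: ltnP => // lt_ji; rewrite -val_eqE /= ltn_eqF //.
by apply: leq_trans (narrow_le yL (ltnW lt_ji)); apply: leq_ltn_trans lt_c.
Qed.

Lemma fillings_exist : exists t, filling L t.
Proof.
exists [seq (i, c) | i <- iota 0 (size l), c <- iota 0 (L i)].
split=> [|[i c]].
  apply: allpairs_uniq_dep => [|i _|[i c] [j d] _ _ /= [-> ->] //]; exact: iota_uniq.
apply/allpairsPdep/idP => [[i' [c' []]]|lt_c].
  by rewrite !mem_iota => _ /= lt_c [-> ->].
exists i, c; rewrite !mem_iota; split=> //=.
by rewrite add0n ltnNge; apply: contraTN lt_c => le_i; rewrite /L /weight nth_default.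
Qed.

Lemma size_filling t : filling L t -> size t = n.
Proof.
move=> fill_t; rewrite -(size_map fst); apply: size_content_weight => i.
exact: filling_rows.
Qed.

Definition nodes (tau : tableau n l) : seq (nat * nat) :=
  [seq ((val tau x).1 : nat, (val tau x).2 : nat) | x <- enum 'I_n].

Lemma nth_nodes tau (x : 'I_n) :
  nth (0, 0)%N (nodes tau) x = ((val tau x).1 : nat, (val tau x).2 : nat).
Proof. by rewrite (nth_map x) ?size_enum_ord // nth_ord_enum. Qed.

Lemma filling_nodes tau : filling L (nodes tau).
Proof.
case/andP: (valP tau) => /injectiveP tau_inj /eqP tau_im; split.
  rewrite map_inj_uniq ?enum_uniq // => x y [/val_inj eq1 /val_inj eq2].
  apply: tau_inj; rewrite [LHS]surjective_pairing [RHS]surjective_pairing.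
  by congr (_, _).
move=> [i c]; apply/mapP/idP => [[x _ [-> ->]] /=|/= lt_c].
  have : val tau x \in diagram n l by rewrite -tau_im imset_f ?inE.
  by rewrite inE.
have /andP[lt_i lt_cn] := node_lt lt_c.
have : (Ordinal lt_i, Ordinal lt_cn) \in diagram n l by rewrite inE.
by rewrite -tau_im => /imsetP[x _ eq_x]; exists x; rewrite ?mem_enum // -eq_x.
Qed.

(** The bijection between tableaux and fillings is onto, so a combination of
    [polycoef] over fillings is an element of the Specht module. *)
Lemma nodes_surj t : filling L t -> exists tau, nodes tau = t.
Proof.
move=> fill_t; have [t_uniq t_mem] := fill_t; have szt := size_filling fill_t.
have bnd (x : 'I_n) : ((nth (0, 0)%N t x).1 < n)%N && ((nth (0, 0)%N t x).2 < n)%N.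
  by apply: node_lt; rewrite -t_mem mem_nth // szt.
pose f := [ffun x : 'I_n => (Ordinal (proj1 (andP (bnd x))), Ordinal (proj2 (andP (bnd x))))].
have fE (x : 'I_n) : nth (0, 0)%N t x = ((f x).1 : nat, (f x).2 : nat).
  by rewrite ffunE /= -surjective_pairing.
have f_tab : is_tableau l f.
  apply/andP; split.
    apply/injectiveP => x y eq_xy; apply/val_inj.
    have /eqP : nth (0, 0)%N t x = nth (0, 0)%N t y by rewrite !fE eq_xy.
    by rewrite nth_uniq ?szt // => /eqP.
  apply/eqP/setP => -[i c]; rewrite inE /=; apply/imsetP/idP => [[x _ eq_x]|lt_c].
    have := mem_nth (0, 0)%N (_ : (x < size t)%N); rewrite szt ltn_ord => /(_ erefl).
    by rewrite fE -eq_x t_mem.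
  have : (i : nat, c : nat) \in t by rewrite t_mem.
  case/(nthP (0, 0)%N) => x; rewrite szt => lt_x eq_x; exists (Ordinal lt_x); first by rewrite inE.
  have := fE (Ordinal lt_x); rewrite eq_x => -[eq_i eq_c].
  apply/eqP; rewrite [X in _ == X]surjective_pairing xpair_eqE -!val_eqE /=.
  by rewrite -eq_i -eq_c !eqxx.
exists (exist (fun t' => is_true (is_tableau l t')) f f_tab).
apply: (@eq_from_nth _ (0, 0)%N) => [|x]; first by rewrite size_map size_enum_ord.
rewrite size_map size_enum_ord => lt_x.
by rewrite (nth_nodes _ (Ordinal lt_x)) /= -(fE (Ordinal lt_x)).
Qed.

Lemma polycoefE t T : size t = n ->
  polycoef t T = \sum_(s : 'S_n) (-1) ^+ s * \prod_(x < n)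
    (((nth (0, 0)%N t x).2 == (nth (0, 0)%N t (s x)).2)
     && (nth 0%N T x == (nth (0, 0)%N t (s x)).1))%:R.
Proof.
move=> szt; subst n; rewrite /polycoef /determinant; apply: eq_bigr => s _; congr (_ * _).
by apply: eq_bigr => x _; rewrite mxE.
Qed.

(** The product over the entries in the Leibniz expansion is 1 exactly for the
    permutations s of the column stabilizer whose action gives the tabloid T. *)
Lemma polytabloid_polycoef tau (T : tabloid n l) :
  polytabloid tau T = polycoef (nodes tau) (word (val T)).
Proof.
rewrite polycoefE; last by rewrite size_map size_enum_ord.
rewrite /polytabloid sum_ffunE big_mkcond; apply: eq_bigr => s _.
rewrite ffunMzE ffunE.
have -> : (\prod_(x < n) (((nth (0, 0)%N (nodes tau) x).2 == (nth (0, 0)%N (nodes tau) (s x)).2)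
     && (nth 0%N (word (val T)) x == (nth (0, 0)%N (nodes tau) (s x)).1))%:R : int) =
  ((s \in column_stabilizer tau) && (T == tabloid_act s (tabloid_of tau)))%:R.
  case: (boolP (_ && _)) => [/andP[]|].
    rewrite inE => /forallP /= s_col /eqP ->; apply: big1 => x _.
    rewrite !nth_nodes nth_word /= !ffunE /= eqxx andbT.
    by have := s_col x; rewrite -val_eqE /= eq_sym => ->.
  move=> neq; apply/eqP; rewrite -[0%:R]/0; apply/prodf_eq0.
  apply/exists_inP; apply: contraR neq; rewrite negb_exists_in => /forall_inP /= hs.
  have hs' (x : 'I_n) : ((nth (0, 0)%N (nodes tau) x).2 == (nth (0, 0)%N (nodes tau) (s x)).2)
     && (nth 0%N (word (val T)) x == (nth (0, 0)%N (nodes tau) (s x)).1).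
    by have := hs x erefl; case: (_ && _).
  apply/andP; split.
    rewrite inE; apply/forallP => x; have := hs' x; rewrite !nth_nodes /=.
    by case/andP=> /eqP/val_inj ->.
  apply/eqP/val_inj/ffunP => x; have := hs' x; rewrite !nth_nodes nth_word /=.
  by case/andP=> _ /eqP/val_inj ->; rewrite !ffunE.
case: (s \in _) => /=; last by rewrite mulr0.
by rewrite -mulrzl intz.
Qed.

Lemma content_word (T : tabloid n l) : content L (word (val T)).
Proof.
case: T => T /= /codomP[tau ->] i; rewrite -(filling_rows i (filling_nodes tau)).
rewrite /unzip1 /nodes -map_comp /word; congr (count _ _); apply: eq_map => x.
by rewrite /= ffunE.
Qed.

Lemma word_tabloid_act (s : 'S_n) (T : tabloid n l) :
  word (val (tabloid_act s T)) = word_act s (word (val T)).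
Proof. by apply: eq_map => x; rewrite nth_word /= ffunE. Qed.

Lemma content_perm V W : content L V -> content L W -> perm_eq V W.
Proof. by move=> hV hW; apply: count_mem_perm => i; rewrite hV hW. Qed.

Lemma tabloid_trans (T T' : tabloid n l) : exists s, T' = tabloid_act s T.
Proof.
have [s eq_s] := word_act_trans (size_word (val T))
  (content_perm (content_word T') (content_word T)).
by exists s; apply/val_inj/word_inj; rewrite word_tabloid_act.
Qed.

(** One tableau exists, and the permutations of its word are the words of the
    same content. *)
Lemma content_tabloid W : content L W -> exists T : tabloid n l, word (val T) = W.
Proof.
move=> hW; have [t fill_t] := fillings_exist; have [tau _] := nodes_surj fill_t.
have hT := content_word (tabloid_of tau).
have [s eq_s] := word_act_trans (size_word _) (content_perm hW hT).
by exists (tabloid_act s (tabloid_of tau)); rewrite word_tabloid_act.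
Qed.

(** Outside the words of tabloids the value is the junk value 0; it is never
    looked at, since raising meets only words of the right content. *)
Definition ext (v : permmod n l) (W : seq nat) : int :=
  if [pick T : tabloid n l | word (val T) == W] is Some T then v T else 0.

Lemma ext_word v (T : tabloid n l) : ext v (word (val T)) = v T.
Proof.
rewrite /ext; case: pickP => [T' /eqP/word_inj/val_inj -> //|/(_ T)].
by rewrite eqxx.
Qed.

Lemma ext_eq (v : permmod n l) (F : seq nat -> int) : (forall T, v T = F (word (val T))) ->
  forall W, content L W -> ext v W = F W.
Proof. by move=> hv W /content_tabloid[T <-]; rewrite ext_word. Qed.

Lemma eq_raise j F G T : raised j L T ->
  (forall T, content L T -> F T = G T) -> raise j F T = raise j G T.
Proof.
move=> hT hFG; apply: eq_bigr => x /eqP Tx.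
exact/hFG/(content_set_nth _ Tx hT).
Qed.

Lemma raise_extD j (v w : permmod n l) T : raised j L T ->
  raise j (ext (v + w)) T = raise j (ext v) T + raise j (ext w) T.
Proof.
move=> hT; rewrite -raiseD; apply: eq_raise hT _ => W /content_tabloid[T' <-].
by rewrite !ext_word ffunE.
Qed.

Lemma raise_extN j (v : permmod n l) T : raised j L T ->
  raise j (ext (- v)) T = - raise j (ext v) T.
Proof.
move=> hT; rewrite -[RHS]mulN1r -raiseZ; apply: eq_raise hT _ => W /content_tabloid[T' <-].
by rewrite !ext_word ffunE mulN1r.
Qed.

Lemma raise_extMn j (v : permmod n l) m T : raised j L T ->
  raise j (ext (v *+ m)) T = raise j (ext v) T *+ m.
Proof.
move=> hT; rewrite -[RHS]mulr_natl -raiseZ; apply: eq_raise hT _ => W /content_tabloid[T' <-].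
by rewrite !ext_word ffunMnE mulr_natl.
Qed.

Lemma raise_ext_act j (s : 'S_n) (v : permmod n l) T : raised j L T ->
  raise j (ext (permmod_act s v)) T = raise j (ext v) (word_act s^-1 T).
Proof.
move=> hT; rewrite -raise_word_act; last exact: size_raised_weight hT.
apply: eq_raise hT _ => W /content_tabloid[T' <-].
by rewrite -word_tabloid_act !ext_word ffunE.
Qed.

Lemma kernel_specht N (v : permmod n l) : specht v -> kernel N L (ext v).
Proof.
case=> c ->; pose c' := [seq (c tau, nodes tau) | tau <- index_enum (tableau n l)].
have fill_c' : fillings L c' by move=> _ /mapP[tau _ ->]; exact: filling_nodes.
move=> j T hT; have := kernel_comb N yL fill_c' hT; congr (_ %| _)%Z.
apply: eq_raise hT _ => W /content_tabloid[T' <-]; rewrite ext_word sum_ffunE /combination big_map.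
by apply: eq_bigr => tau _; rewrite /= ffunMzE polytabloid_polycoef -mulrzl intz.
Qed.

Lemma specht_comb c : fillings L c -> exists2 v, specht v &
  forall T : tabloid n l, v T = combination c (word (val T)).
Proof.
elim: c => [|[a t] c IH] fill_c.
  exists 0 => [|T]; last by rewrite /combination big_nil ffunE.
  by exists (fun=> 0); rewrite big1 // => tau _; rewrite mulr0z.
have [|v [d ->] hv] := IH; first by move=> p c_p; apply: fill_c; rewrite inE c_p orbT.
have [tau nodes_tau] := nodes_surj (fill_c (a, t) (mem_head _ _)).
exists (polytabloid tau *~ a + \sum_t polytabloid t *~ d t).
  exists (fun tau' => (tau' == tau)%:R * a + d tau').
  under [RHS]eq_bigr do rewrite mulrzDr; rewrite big_split /=; congr (_ + _).
  rewrite (bigD1 tau) //= eqxx mul1r big1 ?addr0 // => tau' /negbTE ->.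
  by rewrite mul0r mulr0z.
move=> T; rewrite ffunE hv /combination big_cons; congr (_ + _).
by rewrite ffunMzE polytabloid_polycoef nodes_tau -mulrzl intz.
Qed.

(** The kernel theorem for the Specht module, in the form used for cocycles: an
    element of the kernel modulo m is in S + mM. *)
Theorem specht_mod (m : nat) (v : permmod n l) : (forall z, (m %| z * 2)%Z -> (m %| z)%Z) ->
  kernel m L (ext v) -> exists2 s : permmod n l, specht s & exists u, v = s + u *+ m.
Proof.
move=> m2 hv; have [c fill_c hc] := kernel_span m2 yL weight_size hv.
have [s specht_s hs] := specht_comb fill_c; exists s => //.
exists [ffun T => ((v T - s T) %/ m)%Z]; apply/ffunP => T.
rewrite ffunE ffunMnE ffunE -mulr_natr natz divzK ?subrKC //.
by have := hc _ (content_word T); rewrite ext_word hs.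
Qed.

Corollary spechtP (v : permmod n l) : specht v <-> kernel 0 L (ext v).
Proof.
split=> [|hv]; first exact: kernel_specht.
by have [|s hs [u ->]] := specht_mod (m := 0) _ hv; [exact: two_cancel0 | rewrite mulr0n addr0].
Qed.

End Bridge.

(** * Torsion in a finite group of cosets *)
Section Cauchy.

Variables (T : finType) (mul : T -> T -> T) (one : T) (inv : T -> T).
Hypotheses (mulA : associative mul) (mul1 : left_id one mul).
Hypothesis mulV : left_inverse one inv mul.

Let G : Type := T.
HB.instance Definition _ := Finite.on G.
HB.instance Definition _ := Finite_isGroup.Build G mulA mul1 mulV.

(** Cauchy's theorem for a group law on a bare finite type, as needed for a law
    transported along a bijection. *)
Lemma cauchy_card (p : nat) : prime p ->
  (p %| #|T|)%N <-> exists2 x, x <> one & iter p (mul x) one = one.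
Proof.
move=> p_pr; have cardG : #|[set: G]%SET| = #|T|.
  by rewrite cardsT; apply: (@bij_eq_card G T id); exists id.
have iterE (x : G) m : iter m (mul x) one = (x ^+ m)%g.
  by elim: m => [|m IH]; rewrite ?expg0 //= expgS IH.
split=> [|[x ne_x iter_x]].
  rewrite -cardG => /(Cauchy p_pr)[x _ ox]; exists x.
    by move=> x1; move: ox p_pr; rewrite (x1 : x = 1%g) order1 => <-.
  by rewrite iterE -ox expg_order.
have : (#[x : G]%g %| p)%N by rewrite order_dvdn -iterE iter_x eqxx.
case/primeP: p_pr => _ /[apply]; rewrite order_eq1 => /orP[/eqP //|/eqP ox].
by rewrite -cardG -ox order_dvdG // inE.
Qed.

End Cauchy.

Section Cosets.

Variables (W : zmodType) (Z B : set W).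
Hypotheses (Z0 : Z 0) (ZD : forall f g, Z f -> Z g -> Z (f + g)).
Hypotheses (ZN : forall f, Z f -> Z (- f)).
Hypotheses (B0 : B 0) (BD : forall f g, B f -> B g -> B (f + g)).
Hypotheses (BN : forall f, B f -> B (- f)).

Definition zcoset (f : W) : set W := [set f' | B (f' - f)].

Definition zcosets : set (set W) := [set C | exists2 f, Z f & C = zcoset f].

Lemma zcoset_eq f g : zcoset f = zcoset g <-> B (f - g).
Proof.
split=> [eq_fg|Bfg].
  have : zcoset f f by rewrite /zcoset /= subrr.
  by rewrite eq_fg.
apply/predeqP => h; rewrite /zcoset /=; split=> Bh.
  have -> : h - g = (h - f) + (f - g) by rewrite addrA subrK.
  exact: BD.
have -> : h - f = (h - g) - (f - g) by rewrite opprB addrA subrK.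
by apply: BD => //; exact: BN.
Qed.

(** The group law of Z/B is transported to ['I_N] along the given bijection, with
    representatives rho and classes k, and Cauchy's theorem applies to it. *)
Theorem prime_dvd_cosets (N p : nat) : prime p -> (zcosets #= `I_N)%card ->
  (p %| N)%N <-> exists f, [/\ Z f, ~ B f & B (f *+ p)].
Proof.
move=> p_pr /card_set_bijP[b [b_fun b_inj b_surj]].
pose k' f := b (zcoset f).
have cZ f : Z f -> zcosets (zcoset f) by move=> Zf; exists f.
have k'_lt f : Z f -> (k' f < N)%N by move=> /cZ/b_fun.
pose k f : 'I_N := insubd (Ordinal (k'_lt 0 Z0)) (k' f).
have kE f g : Z f -> Z g -> k f = k g <-> B (f - g).
  move=> Zf Zg; rewrite -zcoset_eq; split=> [|eq_fg]; last by rewrite /k /k' eq_fg.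
  move/(congr1 val); rewrite !val_insubd !k'_lt // => /b_inj; apply; rewrite inE; exact: cZ.
have [rho rhoP] : exists rho : 'I_N -> W, forall i, Z (rho i) /\ k (rho i) = i.
  suff : forall i, exists f, Z f /\ k f = i by case/choice=> rho; exists rho.
  move=> i.
  have [_ [f Zf ->] bf] := b_surj i (ltn_ord i); exists f; split=> //.
  by apply/val_inj; rewrite val_insubd k'_lt.
have Zrho i : Z (rho i) by case: (rhoP i).
have rhoK i : k (rho i) = i by case: (rhoP i).
have k_rho f : Z f -> B (rho (k f) - f) by move=> Zf; apply/kE.
have kDr f g : Z f -> Z g -> k (f + rho (k g)) = k (f + g).
  move=> Zf Zg; apply/kE; [exact: ZD | exact: ZD |].
  by rewrite opprD addrACA subrr add0r; exact: k_rho.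
have kDl f g : Z f -> Z g -> k (rho (k f) + g) = k (f + g).
  by move=> Zf Zg; rewrite addrC kDr // addrC.
pose mul i j := k (rho i + rho j).
have mulA : associative mul.
  by move=> i j l; rewrite /mul kDr ?kDl ?addrA //; exact: ZD.
have mul1 : left_id (k 0) mul by move=> i; rewrite /mul kDl ?add0r.
have mulV : left_inverse (k 0) (fun i => k (- rho i)) mul.
  by move=> i; rewrite /mul kDl ?addNr //; exact: ZN.
have ZMn f m : Z f -> Z (f *+ m).
  by move=> Zf; elim: m => [|m IH]; rewrite ?mulr0n ?mulrS //; exact: ZD.
have iterE i m : iter m (mul i) (k 0) = k (rho i *+ m).
  elim: m => [|m IH] //=; rewrite IH /mul kDr ?mulrS //; exact: ZMn.
rewrite -[N in (p %| N)%N]card_ord (cauchy_card mulA mul1 mulV p_pr); split=> [[i ne_i]|[f [Zf nBf Bpf]]].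
  rewrite iterE => /kE Bi; exists (rho i); split=> // [Bi1|].
    by apply: ne_i; rewrite -[LHS]rhoK; apply/kE; rewrite ?subr0.
  by rewrite -[_ *+ p]subr0; apply: Bi => //; exact: ZMn.
exists (k f).
  by move=> /kE kf; apply: nBf; rewrite -[f]subr0; apply: kf.
rewrite iterE; apply/kE; [exact: ZMn | exact: Z0 | rewrite subr0].
have -> : rho (k f) *+ p = (rho (k f) - f) *+ p + f *+ p by rewrite -mulrnDl subrK.
apply: BD => //; elim: p {p_pr Bpf} => [|m IH]; rewrite ?mulr0n ?mulrS //.
by apply: BD => //; exact: k_rho.
Qed.

End Cosets.

(** * Second cohomology of a finite group *)
Section Cohomology.

Variables (gT : finGroupType) (V : zmodType) (act : gT -> V -> V) (S : set V).
Hypotheses (actM : forall g h v, act (g * h)%g v = act g (act h v)).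
Hypothesis actD : forall g v w, act g (v + w) = act g v + act g w.
Hypotheses (S0 : S 0) (SD : forall v w, S v -> S w -> S (v + w)).
Hypothesis SN : forall v, S v -> S (- v).

Notation Z := (cocycle2 act S).
Notation B := (coboundary2 act S).

Lemma act0 g : act g 0 = 0.
Proof. by apply: (@addrI _ (act g 0)); rewrite -actD !addr0. Qed.

Lemma actN g v : act g (- v) = - act g v.
Proof. by apply: (@addrI _ (act g v)); rewrite -actD !subrr act0. Qed.

Lemma actMn g v m : act g (v *+ m) = act g v *+ m.
Proof. by elim: m => [|m IH]; rewrite ?mulr0n ?act0 // !mulrS actD IH. Qed.

Lemma act_sum (I : Type) (r : seq I) (P : pred I) (F : I -> V) g :
  act g (\sum_(i <- r | P i) F i) = \sum_(i <- r | P i) act g (F i).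
Proof. exact: (big_morph _ (actD g) (act0 g)). Qed.

Lemma S_sum (I : Type) (r : seq I) (P : pred I) (F : I -> V) :
  (forall i, S (F i)) -> S (\sum_(i <- r | P i) F i).
Proof. by move=> SF; apply: big_ind. Qed.

Definition delta1 (c : gT -> V) (g h : gT) : V := act g (c h) - c (g * h)%g + c g.

Definition delta2 (f : gT -> gT -> V) (g h k : gT) : V :=
  act g (f h k) - f (g * h)%g k + f g (h * k)%g - f g h.

Lemma delta2D f f' g h k :
  delta2 (f + f') g h k = delta2 f g h k + delta2 f' g h k.
Proof.
rewrite /delta2 -[(f + f') h k]/(f h k + f' h k) -![(f + f') _ _]/(f _ _ + f' _ _) actD.
rewrite !opprD !addrA.
by rewrite [LHS](AC 8 ((((1*3)*5)*7)*(((2*4)*6)*8))) /= !addrA.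
Qed.

Lemma delta2N f g h k : delta2 (- f) g h k = - delta2 f g h k.
Proof.
rewrite /delta2 -![(- f) _ _]/(- f _ _) actN.
by rewrite !opprD !opprK.
Qed.

Lemma delta2_delta1 c g h k : delta2 (delta1 c) g h k = 0.
Proof.
rewrite /delta2 /delta1 !actD !actN -actM -mulgA.
rewrite !opprD !opprK !addrA.
rewrite [LHS](AC 12 ((1*4)*(2*7)*(3*10)*(5*8)*(6*11)*(9*12))) /=.
by rewrite !(subrr, addNr, addr0).
Qed.

Lemma cocycle2P f : Z f <-> (forall g h, S (f g h)) /\ forall g h k, delta2 f g h k = 0.
Proof. by []. Qed.

Lemma coboundary2P f : B f <-> exists2 c, (forall g, S (c g)) & f = delta1 c.
Proof.
split=> [[c Sc hc]|[c Sc ->]]; last by exists c.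
by exists c => //; apply/funext => g; apply/funext => h; exact: hc.
Qed.

Lemma delta1D c c' : delta1 (c + c') = delta1 c + delta1 c'.
Proof.
apply/funext => g; apply/funext => h; rewrite -[RHS]/(delta1 c g h + delta1 c' g h).
rewrite /delta1 -![(c + c') _]/(c _ + c' _) actD opprD !addrA.
by rewrite [LHS](AC 6 (((1*3)*5)*((2*4)*6))) /= !addrA.
Qed.

Lemma delta1N c : delta1 (- c) = - delta1 c.
Proof.
apply/funext => g; apply/funext => h; rewrite -[RHS]/(- delta1 c g h).
by rewrite /delta1 -![(- c) _]/(- c _) actN !opprD !opprK.
Qed.

Lemma cocycle2D f f' : Z f -> Z f' -> Z (f + f').
Proof.
move=> /cocycle2P[Sf df] /cocycle2P[Sf' df']; apply/cocycle2P.
by split=> [g h|g h k]; [exact: SD | rewrite delta2D df df' addr0].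
Qed.

Lemma cocycle2N f : Z f -> Z (- f).
Proof.
move=> /cocycle2P[Sf df]; apply/cocycle2P.
by split=> [g h|g h k]; [exact: SN | rewrite delta2N df oppr0].
Qed.

Lemma cocycle20 : Z 0.
Proof.
by apply/cocycle2P; split=> // g h k; rewrite /delta2 act0 !subr0 addr0.
Qed.

Lemma coboundary2D f f' : B f -> B f' -> B (f + f').
Proof.
move=> /coboundary2P[c Sc ->] /coboundary2P[c' Sc' ->]; apply/coboundary2P.
by exists (c + c') => [g|]; [exact: SD | rewrite delta1D].
Qed.

Lemma coboundary2N f : B f -> B (- f).
Proof.
move=> /coboundary2P[c Sc ->]; apply/coboundary2P.
by exists (- c) => [g|]; [exact: SN | rewrite delta1N].
Qed.

Lemma coboundary20 : B 0.
Proof.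
apply/coboundary2P; exists 0 => //; apply/funext => g; apply/funext => h.
by rewrite /delta1 act0 subrr addr0.
Qed.

Lemma H2_cosets : H2 act S = zcosets Z B.
Proof. by []. Qed.

(** The order of the group kills its cohomology: sum the cocycle identity over
    the last variable. *)
Lemma card_mul_cocycle f : Z f -> B (f *+ #|gT|).
Proof.
move=> /cocycle2P[Sf df]; apply/coboundary2P; exists (fun g => \sum_k f g k).
  by move=> g; exact: S_sum.
apply/funext => g; apply/funext => h; rewrite /delta1 act_sum.
have -> : (f *+ #|gT|) g h = \sum_(k : gT) f g h.
  rewrite sumr_const; elim: #|_| => [|m IH]; first by rewrite !mulr0n.
  by rewrite !mulrS -IH.
rewrite [X in _ + X](reindex_inj (mulgI h)) /=.
rewrite -sumrB -big_split /=; apply: eq_bigr => k _; apply/eqP.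
by rewrite eq_sym -subr_eq0; apply/eqP; exact: df.
Qed.

Hypothesis S_pure : forall v m, (0 < m)%N -> S (v *+ m) -> S v.
Hypothesis mulrn_inj0 : forall (v : V) m, (0 < m)%N -> v *+ m = 0 -> v = 0.
Hypothesis finite_mod : forall m, (0 < m)%N ->
  exists (X : finType) (q : V -> X), forall v w, q v = q w -> exists u, v = w + u *+ m.

Lemma delta2Mn f m g h k : delta2 (fun g h => f g h *+ m) g h k = delta2 f g h k *+ m.
Proof. by rewrite /delta2 actMn !mulrnDl !mulNrn. Qed.

(** Two cocycles that agree modulo the group order differ by that multiple of a
    cochain u. As S is pure and the module torsion free, u is again a cocycle
    with values in S, so its multiple is a coboundary. Hence a class is
    determined by a cocycle modulo the group order. *)
Lemma H2_finite : finite_set (H2 act S).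
Proof.
have cG : (0 < #|gT|)%N by rewrite -cardsT cardG_gt0.
have [X [q qP]] := finite_mod cG.
pose F (y : {ffun gT * gT -> X}) : set (gT -> gT -> V) :=
  if pselect (exists2 f, Z f & forall g h, q (f g h) = y (g, h)) is left ex
  then zcoset B (projT1 (cid2 ex)) else set0.
apply: (@sub_finite_set _ _ (F @` setT)); last exact/finite_image/finite_finset.
move=> C [f Zf ->]; exists [ffun p => q (f p.1 p.2)] => //.
rewrite /F; case: pselect => [ex|[]]; last by exists f => // g h; rewrite ffunE.
case: (cid2 ex) => f' Zf' /= qf'; rewrite -[RHS]/(zcoset B f).
apply/(zcoset_eq coboundary20 coboundary2D coboundary2N).
have [u uP] : exists u, forall g h, f' g h = f g h + u g h *+ #|gT|.
  have ex_u p : exists u, f' p.1 p.2 = f p.1 p.2 + u *+ #|gT|.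
    by apply: qP; rewrite qf' ffunE.
  by have [u uP] := choice ex_u; exists (fun g h => u (g, h)) => g h; exact: (uP (g, h)).
have -> : f' - f = (fun g h => u g h *+ #|gT|).
  apply/funext => g; apply/funext => h; rewrite -[LHS]/(f' g h - f g h) uP.
  by rewrite addrC addKr.
have /cocycle2P[Su du] : Z (f' - f) by apply: cocycle2D => //; exact: cocycle2N.
have uE g h : u g h *+ #|gT| = (f' - f) g h.
  by rewrite -[RHS]/(f' g h - f g h) uP addrC addKr.
have : Z u.
  apply/cocycle2P; split=> [g h|g h k].
    by apply: (S_pure cG); rewrite uE.
  apply: (mulrn_inj0 cG); rewrite -delta2Mn -[RHS](du g h k).
  by rewrite /delta2 !uE.
move/card_mul_cocycle; congr B; apply/funext => g; apply/funext => h.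
by elim: #|_| => [|m IH]; rewrite ?mulr0n // !mulrS -IH.
Qed.

Lemma delta1Mn c m g h : delta1 (fun g => c g *+ m) g h = delta1 c g h *+ m.
Proof. by rewrite /delta1 actMn !mulrnDl !mulNrn. Qed.

Lemma delta1_principal v g h : delta1 (fun g => act g v - v) g h = 0.
Proof.
rewrite /delta1 actD actN -actM !opprD !opprK !addrA.
by rewrite [LHS](AC 6 ((1*3)*(2*5)*(4*6))) /= !(subrr, addNr, addr0).
Qed.

(** The first cohomology is killed by the order of the group, in explicit form. *)
Lemma crossed_principal d : (forall g h, delta1 d g h = 0) ->
  forall g, d g *+ #|gT| = act g (- \sum_h d h) - (- \sum_h d h).
Proof.
move=> dd g; rewrite actN opprK act_sum.
rewrite [X in _ + X](reindex_inj (mulgI g)) /= addrC -sumrB -[LHS]sumr_const.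
apply: eq_bigr => h _; apply/eqP; rewrite -subr_eq0 -[X in _ == X](dd g h) /delta1.
by rewrite opprB addrC.
Qed.

Theorem dvd_card_H2 p : prime p ->
  dvd_card p (H2 act S) <-> exists f, [/\ Z f, ~ B f & B (f *+ p)].
Proof.
move=> p_pr; have main N : (H2 act S #= `I_N)%card ->
    (p %| N)%N <-> exists f, [/\ Z f, ~ B f & B (f *+ p)].
  rewrite H2_cosets; apply: prime_dvd_cosets => //.
  - exact: cocycle20.
  - exact: cocycle2D.
  - exact: cocycle2N.
  - exact: coboundary20.
  - exact: coboundary2D.
  - exact: coboundary2N.
split=> [[N cardN pN]|ex]; first exact/(main N cardN).
by have /finite_setP[N cardN] := H2_finite; exists N => //; exact/(main N cardN).
Qed.

End Cohomology.

Lemma dvdz_muln (z : int) (m : nat) : (m %| z *+ m)%Z.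
Proof. by rewrite -mulr_natr natz dvdz_mull. Qed.

(** * Classes of order 3 with values in a Specht module *)
Lemma cross_dvd (N : nat) (a b z p q : int) : N%:Z != 0 ->
  ((3 * N)%:Z %| a * N%:Z - z * p)%Z -> ((3 * N)%:Z %| b * N%:Z - z * q)%Z ->
  (3 %| a * q - b * p)%Z.
Proof.
move=> N0 ha hb; rewrite -(dvdz_mul2r N0).
have -> : (a * q - b * p) * N%:Z = (a * N%:Z - z * p) * q - (b * N%:Z - z * q) * p by ring.
by rewrite PoszM in ha hb; apply: rpredB; exact: dvdz_mulr.
Qed.

Lemma cross_dvd_congr (N a b y y' p q : int) :
  (N %| a - y)%Z -> (N %| b - y')%Z -> (N %| a * q - b * p)%Z -> (N %| y * q - y' * p)%Z.
Proof.
move=> ha hb hab.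
have -> : y * q - y' * p = (a * q - b * p) - ((a - y) * q - (b - y') * p) by ring.
by apply: rpredB => //; apply: rpredB; exact: dvdz_mulr.
Qed.

Section SpechtCohomology.

Variables (n : nat) (l : seq nat).
Hypothesis part_l : is_partition n l.

Let L := weight l.

Hypothesis yL : narrow L.

Notation V := (permmod n l).
Notation S := (@specht n l).
Notation act := (@permmod_act n l).

Lemma permmod_actD (s : 'S_n) (v w : V) : act s (v + w) = act s v + act s w.
Proof. by apply/ffunP => T; rewrite !ffunE. Qed.

Lemma ext0 W : ext (0 : V) W = 0.
Proof. by rewrite /ext; case: pickP => // T _; rewrite ffunE. Qed.

Lemma specht_raise (v : V) : S v <-> forall j T, raised j L T -> raise j (ext v) T = 0.
Proof.
split=> [/(spechtP part_l yL) hv j T /hv|hv]; first by rewrite dvd0z => /eqP.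
by apply/(spechtP part_l yL) => j T /hv ->.
Qed.

Lemma specht0 : S 0.
Proof. by apply/specht_raise => j T _; rewrite /raise big1 // => x _; rewrite ext0. Qed.

Lemma spechtD (v w : V) : S v -> S w -> S (v + w).
Proof.
move=> /specht_raise hv /specht_raise hw; apply/specht_raise => j T hT.
by rewrite (raise_extD part_l yL) // hv // hw // addr0.
Qed.

Lemma spechtN (v : V) : S v -> S (- v).
Proof.
move=> /specht_raise hv; apply/specht_raise => j T hT.
by rewrite (raise_extN part_l yL) // hv // oppr0.
Qed.

Lemma raised_act j (s : 'S_n) T : raised j L T -> raised j L (word_act s T).
Proof. by move=> hT; apply/(perm_raised L j (word_act_perm s (size_raised_weight part_l yL hT))). Qed.

Lemma specht_act s (v : V) : S v -> S (act s v).
Proof.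
move=> /specht_raise hv; apply/specht_raise => j T hT.
by rewrite (raise_ext_act part_l yL) // hv //; exact: raised_act.
Qed.

Lemma specht_pure (v : V) m : (0 < m)%N -> S (v *+ m) -> S v.
Proof.
move=> m_gt0 /specht_raise hv; apply/specht_raise => j T hT.
have := hv j T hT; rewrite (raise_extMn part_l yL) // => /eqP.
by rewrite Num.Theory.mulrn_eq0 eqn0Ngt m_gt0 => /eqP.
Qed.

Lemma permmod_mulrn_eq0 (v : V) m : (0 < m)%N -> v *+ m = 0 -> v = 0.
Proof.
move=> m_gt0 /ffunP hv; apply/ffunP => T; have := hv T.
by rewrite ffunMnE ffunE => /eqP; rewrite Num.Theory.mulrn_eq0 eqn0Ngt m_gt0 => /eqP.
Qed.

Lemma permmod_finite_mod m : (0 < m)%N ->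
  exists (X : finType) (q : V -> X), forall v w, q v = q w -> exists u, v = w + u *+ m.
Proof.
case: m => // m _; exists {ffun tabloid n l -> 'I_m.+1}.
exists (fun v => [ffun T => inord `|(v T %% m.+1)%Z|%N]) => v w /ffunP eq_q.
exists [ffun T => ((v T - w T) %/ m.+1)%Z]; apply/ffunP => T.
rewrite ffunE ffunMnE ffunE -mulr_natr natz divzK ?subrKC //.
rewrite -eqz_mod_dvd; have := eq_q T; rewrite !ffunE => /(congr1 val).
have mod_lt (z : int) : (`|(z %% m.+1)%Z| < m.+1)%N.
  by have := ltz_pmod z (isT : 0 < m.+1%:Z)%R; have := modz_ge0 z (isT : m.+1%:Z != 0); lia.
rewrite /= !inordK // => eq_abs; apply/eqP.
by rewrite -[LHS]gez0_abs ?modz_ge0 // eq_abs gez0_abs ?modz_ge0.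
Qed.

Definition specht_H2 p (p_pr : prime p) :=
  dvd_card_H2 permmod_actD specht0 spechtD spechtN
    specht_pure permmod_mulrn_eq0 permmod_finite_mod p_pr.

Lemma raised_exists j : (0 < L j.+1)%N -> exists T, raised j L T.
Proof.
move=> L_gt0; have [t fill_t] := fillings_exist l.
have hT : content L (unzip1 t) by move=> i; exact: filling_rows.
have [x lt_x Tx] := content_nth hT L_gt0.
by exists (set_nth 0%N (unzip1 t) x j); exact: raised_set_nth hT.
Qed.

Lemma raised_trans j T T' : raised j L T -> raised j L T' ->
  exists s : 'S_n, T' = word_act s T.
Proof.
move=> hT hT'; apply: word_act_trans (size_raised_weight part_l yL hT) _.
by apply: count_mem_perm => i; have := hT i; have := hT' i; lia.
Qed.

(** The hypothesis says that y is not proportional to (L_j + 1) on the rows r and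
    r+1. If the cocycle were the coboundary of b, then d = s + 3b would be a
    crossed homomorphism into S, and N d would be principal, given by some v in
    S, where N is the order of the group. Then z = N w - v is constant modulo 3N,
    and v is killed by raising, so N y_j is a constant multiple of (L_j + 1)
    modulo 3N, with the same factor for all j. *)
Theorem specht_H2_nontrivial F y r :
  raises L y F -> (0 < L r.+1)%N -> (0 < L r.+2)%N ->
  ~~ (3 %| y r * (L r.+1).+1%:R - y r.+1 * (L r).+1%:R)%Z ->
  dvd_card 3 (H2 act S).
Proof.
move=> hF L1 L2 ny; apply/(specht_H2 (isT : prime 3)).
pose w : V := [ffun T => F (word (val T))].
have wF j T : raised j L T -> raise j (ext w) T = raise j F T.
  move=> hT; apply: eq_raise hT _ => W hW; apply: (ext_eq part_l yL) hW => T'.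
  by rewrite ffunE.
have [su suP] : exists su : 'S_n -> V * V,
    forall g, S (su g).1 /\ act g w - w = (su g).1 + (su g).2 *+ 3.
  suff ex g : exists p : V * V, S p.1 /\ act g w - w = p.1 + p.2 *+ 3.
    by case/choice: ex => su; exists su.
  have [||s Ss [u eq_su]] := specht_mod part_l yL (m := 3) (v := act g w - w).
  - exact: two_cancel3.
  - move=> j T hT; have hgT := raised_act g^-1 hT.
    rewrite (raise_extD part_l yL) // (raise_extN part_l yL) // (raise_ext_act part_l yL) //.
    rewrite !wF //; have -> : raise j F (word_act g^-1 T) - raise j F T =
      (raise j F (word_act g^-1 T) - y j) - (raise j F T - y j) by ring.
    by rewrite rpredB ?hF.
  by exists (s, u).
pose s g := (su g).1; pose u g := (su g).2.
have Ss g : S (s g) by case: (suP g).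
have eq_su g : act g w - w = s g + u g *+ 3 by case: (suP g).
have actD := permmod_actD; have actM := @permmod_actM n l.
have du3 g h : delta1 act u g h *+ 3 = - delta1 act s g h.
  apply/eqP; rewrite -addr_eq0 -(delta1Mn actD); apply/eqP.
  rewrite -[RHS](delta1_principal actM actD w g h).
  have -> : (fun g => act g w - w) = (fun g => u g *+ 3) + s.
    by apply/funext => k; rewrite eq_su addrC.
  rewrite [in RHS](delta1D actD); exact: erefl.
have Sds g h : S (delta1 act s g h).
  by apply: spechtD => //; apply: spechtD; [exact: specht_act | exact: spechtN].
exists (delta1 act u); split.
- apply/cocycle2P; split=> [g h|g h k]; last exact: delta2_delta1.
  by apply: (specht_pure (m := 3)) => //; rewrite du3; exact: spechtN.
- case/coboundary2P=> b Sb eq_b.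
  (* d is a crossed homomorphism because 3 delta1 u = - delta1 s and u has the
     same coboundary as b. *)
  pose d g := s g + b g *+ 3.
  have Sd g : S (d g) by apply: spechtD => //; rewrite !mulrS mulr0n addr0; do !apply: spechtD.
  have dd g h : delta1 act d g h = 0.
    have -> : d = s + (fun g => b g *+ 3) by [].
    rewrite (delta1D actD) -[LHS]/(delta1 _ _ _ _ + delta1 _ _ _ _) (delta1Mn actD) -eq_b du3.
    by rewrite subrr.
  pose v := - \sum_h d h; have Sv : S v.
    by apply: spechtN; apply: (S_sum specht0 spechtD).
  pose N := #|'S_n|; pose z := w *+ N - v.
  have zP g : act g z - z = (u g - b g) *+ (3 * N).
    have := crossed_principal actD dd g; rewrite -/v -/N => dv.
    rewrite /z actD (actN actD) (actMn actD) opprD addrACA -mulrnBl eq_su.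
    rewrite -opprD -dv -mulrnBl /d opprD addrACA subrr add0r -mulrnBl -mulrnA mulnC.
    by rewrite mulrnA -mulrnA mulnC.
  have [T0 hT0] : exists T0, content L T0.
    have [t fill_t] := fillings_exist l.
    by exists (unzip1 t) => i; exact: filling_rows.
  have [t0 _] := content_tabloid part_l yL hT0.
  have z_const T : content L T -> ((3 * N)%:Z %| ext z T - z t0)%Z.
    case/(content_tabloid part_l yL) => T' <-; rewrite ext_word.
    have [g ->] := tabloid_trans part_l yL t0 T'.
    have <- : (act g^-1%g z - z) t0 = z (tabloid_act g t0) - z t0.
      by rewrite [LHS]ffunE [X in X + _]ffunE invgK [X in _ + X]ffunE.
    by rewrite zP ffunMnE; exact: dvdz_muln.
  have N_gt0 : (0 < N)%N by rewrite /N -cardsT cardG_gt0.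
  have rz j T : raised j L T ->
      ((3 * N)%:Z %| raise j F T *+ N - z t0 * (L j).+1%:R)%Z.
    move=> hT; have [_ cT] := raised_gt0 hT; rewrite -cT -raise1.
    have := eq_raise_mod hT z_const; congr (_ %| _ - _)%Z.
    rewrite /z (raise_extD part_l yL) // (raise_extN part_l yL) // (raise_extMn part_l yL) //.
    by rewrite wF // (specht_raise v).1 // subr0.
  have [Ta hTa] := raised_exists L1; have [Tb hTb] := raised_exists L2.
  have rz' j T : raised j L T ->
      ((3 * N)%:Z %| raise j F T * N%:Z - z t0 * (L j).+1%:R)%Z.
    by move=> hT; rewrite -[N%:Z]natz mulr_natr; exact: rz.
  have N_neq0 : N%:Z != 0 by lia.
  have h3 := cross_dvd N_neq0 (rz' r Ta hTa) (rz' r.+1 Tb hTb).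
  by case/negP: ny; exact: cross_dvd_congr (hF r Ta hTa) (hF r.+1 Tb hTb) h3.
apply/coboundary2P; exists (- s) => [g|]; first exact: spechtN.
apply/funext => g; apply/funext => h.
rewrite (delta1N actD) -[RHS]/(- delta1 act s g h) -du3.
by rewrite !mulrS mulr0n.
Qed.

Definition crossed_mod3 (c : 'S_n -> V) : Prop :=
  forall g h T, (3 %| c (g * h)%g T - c g T - act g (c h) T)%Z.

Lemma tabloid_actM (s s' : 'S_n) (T : tabloid n l) :
  tabloid_act (s * s')%g T = tabloid_act s (tabloid_act s' T).
Proof. by apply/val_inj/ffunP => x; rewrite /= !ffunE permM. Qed.

Lemma tabloid_act1 (T : tabloid n l) : tabloid_act 1%g T = T.
Proof. by apply/val_inj/ffunP => x; rewrite /= !ffunE perm1. Qed.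

Lemma permmod_act_tabloid (s : 'S_n) (v : V) T : act s v (tabloid_act s T) = v T.
Proof. by rewrite ffunE -tabloid_actM mulVg tabloid_act1. Qed.

(** At the tabloid T the values on its stabilizer form a homomorphism to Z/3. It
    kills transpositions, which have order 2, and these generate the stabilizer:
    s moves fewer points after multiplication by the transposition of x and
    s x. *)
Lemma crossed_stabilizer c T : crossed_mod3 c ->
  forall s : 'S_n, tabloid_act s T = T -> (3 %| c s T)%Z.
Proof.
move=> hc.
have c1 : (3 %| c 1%g T)%Z.
  by have := hc 1%g 1%g T; rewrite mulg1 subrr sub0r permmod_act1 rpredN.
have cM s t : tabloid_act s T = T -> (3 %| c (s * t)%g T - c s T - c t T)%Z.
  move=> sT; have := hc s t (tabloid_act s T); rewrite permmod_act_tabloid.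
  by rewrite sT.
have fixE (s : 'S_n) : tabloid_act s T = T <-> forall x, val T (s x) = val T x.
  split=> [sT x|sT]; first by rewrite -[in RHS]sT /= ffunE.
  by apply/val_inj/ffunP => x; rewrite /= ffunE sT.
move=> s; elim: {s}#|_|.+1 {-2}s (ltnSn #|[set x | s x != x]%SET|) => // m IH s.
rewrite ltnS => le_m sT; case: (pickP (fun x => s x != x)) => [x ne_x|fix_s]; last first.
  have -> // : s = 1%g.
  by apply/permP => x; rewrite perm1; apply/eqP; have := fix_s x; rewrite /= => /negbFE.
pose t : 'S_n := tperm x (s x); pose q : 'S_n := (s * t)%g.
have tT : tabloid_act t T = T.
  apply/fixE => z; rewrite /t; case: tpermP => // ->; first by have /fixE := sT.
  by have /fixE -> := sT.
have qT : tabloid_act q T = T by rewrite tabloid_actM tT.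
have ct : (3 %| c t T)%Z.
  have := cM t t tT; rewrite /t tperm2 -addrA -opprD => h.
  apply: two_cancel3; rewrite mulr_natr -[_ *+ 2]opprK rpredN.
  by apply: dvdz_addl c1 _; move: h; rewrite mulr2n.
have cq : (3 %| c q T)%Z.
  apply: IH => //; apply: leq_trans le_m; apply: proper_card; apply/properP; split.
    apply/fintype.subsetP => z; rewrite !inE; apply: contra => /eqP sz.
    rewrite /q permM sz /t tpermD // ?[_ == z]eq_sym; apply/eqP => eq_z.
      by move: ne_x; rewrite -eq_z sz eqxx.
    by move: ne_x; rewrite -eq_z (perm_inj (etrans sz eq_z)) eqxx.
  by exists x; rewrite !inE // /q permM /t tpermR eqxx.
have := cM s t sT; rewrite -/q => h; have := rpredB cq (rpredD h ct).
by rewrite subrK subKr.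
Qed.

(** Shapiro's lemma in degree 1: as the tabloids form one orbit, the class is
    determined by the homomorphism of [crossed_stabilizer], which is zero. The
    value of w at g T0 is - c(g)(g T0), which modulo 3 is independent of the
    choice of g. *)
Lemma crossed_principal_mod3 c : crossed_mod3 c -> (exists T : tabloid n l, True) ->
  exists w : V, forall g T, (3 %| c g T - (act g w - w) T)%Z.
Proof.
move=> hc [T0 _]; have ex T : exists g, T = tabloid_act g T0 by exact: tabloid_trans.
have [r rP] := choice ex.
exists [ffun T => - c (r T) T] => g T.
have -> : c g T - (act g [ffun T => - c (r T) T] - [ffun T => - c (r T) T]) T =
    c g T + act g (c (r (tabloid_act g^-1 T))) T - c (r T) T.
  by rewrite !ffunE; ring.
pose h := r (tabloid_act g^-1 T).
have hT : tabloid_act (g * h)%g T0 = T.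
  by rewrite tabloid_actM /h -rP -tabloid_actM mulgV tabloid_act1.
pose p := ((r T)^-1 * (g * h))%g.
have pT : tabloid_act p T0 = T0.
  by rewrite /p tabloid_actM hT; have := tabloid_actM (r T)^-1 (r T) T0; rewrite mulVg tabloid_act1 -rP.
(* r T and g h both carry T0 to T, so they differ by p in the stabilizer of T0. *)
have h1 := hc g h T.
have h2 : (3 %| c (g * h)%g T - c (r T) T)%Z.
  have := hc (r T) p T; rewrite {1}/p mulKVg.
  have := permmod_act_tabloid (r T) (c p) T0; rewrite -rP => -> h2.
  rewrite -(subrK (c p T0) (_ - _)); apply: rpredD => //.
  exact: crossed_stabilizer.
by have := rpredB h2 h1; congr (_ %| _)%Z; rewrite -/h; ring.
Qed.

(** If 3 f is the coboundary of c, then c is crossed modulo 3 and has the form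
    g w - w modulo 3. Its values are in S, so raising w gives constants y_j; as y
    is proportional to (L_j + 1), w is a constant plus an element s0 of S modulo
    3. So c(g) = g s0 - s0 + 3 b(g), and f is the coboundary of b. *)
Theorem specht_H2_trivial :
  (forall F y, raises L y F ->
     exists a, forall j, (0 < L j.+1)%N -> (3 %| y j - a * (L j).+1%:R)%Z) ->
  ~ dvd_card 3 (H2 act S).
Proof.
move=> hL /(specht_H2 (isT : prime 3))[f [Zf nBf /coboundary2P[c Sc eq_c]]]; apply: nBf.
have actD := permmod_actD; have actM := @permmod_actM n l.
have fE g h : f g h *+ 3 = delta1 act c g h.
  by rewrite -eq_c !mulrS mulr0n.
have c_crossed : crossed_mod3 c.
  move=> g h T; have -> : c (g * h)%g T - c g T - act g (c h) T = - (f g h *+ 3) T.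
    by rewrite fE /delta1 !ffunE; ring.
  by rewrite rpredN ffunMnE; exact: dvdz_muln.
have [T0 hT0] : exists T0, content L T0.
  have [t fill_t] := fillings_exist l.
  by exists (unzip1 t) => i; exact: filling_rows.
have [t0 _] := content_tabloid part_l yL hT0.
have [w hw] := crossed_principal_mod3 c_crossed (ex_intro _ t0 I).
have ext_w g W : content L W -> (3 %| ext (c g - (act g w - w)) W)%Z.
  by case/(content_tabloid part_l yL) => T <-; rewrite ext_word !ffunE; have := hw g T; rewrite !ffunE.
have w_inv (g : 'S_n) j T : raised j L T ->
    (3 %| raise j (ext w) (word_act g^-1 T) - raise j (ext w) T)%Z.
  move=> hT; have : (3 %| raise j (ext (c g - (act g w - w))) T)%Z.
    apply: rpred_sum => x /eqP Tx; apply: ext_w; exact: content_set_nth Tx hT.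
  rewrite (raise_extD part_l yL) // ((specht_raise _).1 (Sc g)) // add0r.
  rewrite (raise_extN part_l yL) // rpredN (raise_extD part_l yL) //.
  by rewrite (raise_extN part_l yL) // (raise_ext_act part_l yL).
have [y hy] : exists y, raises L y (ext w).
  have ex j : exists a : int, forall T, raised j L T -> (3 %| raise j (ext w) T - a)%Z.
    have [[T1 hT1]|nT] := pselect (exists T, raised j L T); last first.
      by exists 0 => T hT; case: nT; exists T.
    exists (raise j (ext w) T1) => T hT; have [g ->] := raised_trans hT1 hT.
    by have := w_inv g^-1%g j T1 hT1; rewrite invgK.
  by have [y yP] := choice ex; exists y.
have [a ha] := hL _ _ hy.
pose one : V := [ffun=> a].
have [||s0 Ss0 [u0 eq_u0]] := specht_mod part_l yL (m := 3) (v := w - one).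
- exact: two_cancel3.
- move=> j T hT; have [L_gt0 cT] := raised_gt0 hT.
  have -> : raise j (ext (w - one)) T = raise j (ext w) T - a * (L j).+1%:R.
    rewrite (raise_extD part_l yL) // (raise_extN part_l yL) // -cT -raise1; congr (_ - _).
    apply: eq_raise hT _ => W hW; apply: (ext_eq part_l yL) hW => T'.
    by rewrite ffunE.
  by rewrite -(subrK (y j) (raise j (ext w) T)) -addrA rpredD ?hy ?ha.
have one_inv g : act g one = one by apply/ffunP => T; rewrite !ffunE.
have eq_w g : act g w - w = act g s0 - s0 + (act g u0 - u0) *+ 3.
  have -> : w = s0 + u0 *+ 3 + one by rewrite -eq_u0 subrK.
  rewrite 2!actD one_inv (actMn actD) mulrnBl.
  move: (act g u0 *+ 3) (u0 *+ 3) (act g s0) => x1 x2 x3; rewrite !opprD !addrA.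
  by rewrite [LHS](AC 6 ((1*4)*(2*5)*(3*6))) /= subrr addr0 !addrA.
have [b hb] : exists b : 'S_n -> V, forall g, c g = act g s0 - s0 + b g *+ 3.
  exists (fun g => [ffun T => ((c g T - (act g s0 - s0) T) %/ 3)%Z]) => g.
  apply/ffunP => T; rewrite ffunE ffunMnE [X in _ = _ + X *+ _]ffunE -[X in _ + X]mulr_natr natz divzK ?subrKC //.
  have := hw g T; rewrite eq_w => h.
  have -> : c g T - (act g s0 - s0) T = c g T - (act g s0 - s0 + (act g u0 - u0) *+ 3) T
     + ((act g u0 - u0) *+ 3) T by rewrite [X in _ - X + _]ffunE; ring.
  by rewrite rpredD // ffunMnE; exact: dvdz_muln.
apply/coboundary2P; exists b => [g|].
  apply: (specht_pure (m := 3)) => //.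
  have -> : b g *+ 3 = c g - (act g s0 - s0) by rewrite hb addrAC subrr add0r.
  apply: spechtD => //; apply: spechtN; apply: spechtD; last exact: spechtN.
  exact: specht_act.
apply/funext => g; apply/funext => h; apply/eqP; rewrite -subr_eq0; apply/eqP.
apply: (@permmod_mulrn_eq0 _ 3) => //; rewrite mulrnBl fE -(delta1Mn actD).
have -> : c = (fun g => act g s0 - s0) + (fun g => b g *+ 3).
  by apply/funext => k; rewrite hb.
rewrite (delta1D actD) -[X in X - _]/(delta1 _ _ _ _ + delta1 _ _ _ _).
by rewrite (delta1_principal actM actD) add0r subrr.
Qed.

End SpechtCohomology.

(** * The shapes on the path *)
Definition shape (a k r : nat) : seq nat := a :: nseq k 2%N ++ nseq r 1%N.

Lemma weight_shape a k r i : weight (shape a k r) i =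
  (if i == 0 then a else if i <= k then 2 else if i <= k + r then 1 else 0)%N.
Proof.
case: i => [|i] //; rewrite /weight /= nth_cat size_nseq nth_nseq.
case: ltnP => // le_ki; rewrite nth_nseq; congr (if _ then _ else _).
by rewrite ltn_subLR.
Qed.

Lemma sumn_shape a k r : sumn (shape a k r) = (a + k * 2 + r)%N.
Proof. by rewrite /= sumn_cat !sumn_nseq mulnC mul1n addnA. Qed.

Lemma shape_partition a k r : (0 < a)%N -> (k = 0 \/ 1 < a)%N ->
  is_partition (sumn (shape a k r)) (shape a k r).
Proof.
move=> a_gt0 ak; have path_nseq b c m : (c <= b)%N -> path geq b (nseq m c).
  by elim: m b => //= m IH b le_cb; rewrite le_cb IH.
apply/and3P; split=> //.
  rewrite /shape /=; case: ak => [->|a_gt1]; first exact: path_nseq.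
  rewrite cat_path !path_nseq //; case: k => // k.
  by rewrite -[last _ _]/(last 2 (nseq k 2))%N; elim: k.
by rewrite inE mem_cat !mem_nseq !andbF !orbF (ltn_eqF a_gt0).
Qed.

Lemma narrow_shape a k r : (0 < a)%N -> (k = 0 \/ 1 < a)%N -> narrow (weight (shape a k r)).
Proof.
move=> a_gt0 ak i; rewrite !weight_shape /=.
by do ?[case: ifP => ?]; lia.
Qed.

Section FirstColumns.

Variable a : nat.
Hypothesis a_mod3 : (3 %| a.+1)%N.

Lemma a_gt1 : (1 < a)%N.
Proof. by case: a a_mod3 => [|[]]. Qed.

Lemma shape_raise_unit k r j : (j <= k)%N ->
  (3 %| ((weight (shape a k r) j).+1%:R : int))%Z.
Proof.
move=> le_jk; rewrite natz -[(3 %| _)%Z]/(3 %| _)%N weight_shape le_jk.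
by case: eqP.
Qed.

Lemma sym3_class_shape k : exists F,
  raises (remove_node k (weight (shape a k 2))) (fun j => (j == k)%:R) F.
Proof.
have a1 := a_gt1; apply: (@sym3_class _ _ k.+3).
- by apply: narrow_shape; lia.
all: try by rewrite !weight_shape; do ?[case: ifP => ?]; lia.
by move=> j; exact: shape_raise_unit.
Qed.

Lemma remove_shape k r :
  remove_node k.+1 (weight (shape a k.+1 r)) = weight (shape a k r.+1).
Proof.
apply/funext => i; rewrite /remove_node !weight_shape.
by do ?[case: ifP => ?]; lia.
Qed.

Lemma remove_shape0 r :
  remove_node 0 (weight (shape a 0 r)) = weight (shape a.-1 0 r).
Proof.
apply/funext => i; rewrite /remove_node !weight_shape.
by do ?[case: ifP => ?]; lia.
Qed.

Lemma sym4_class_shape k : exists F,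
  raises (remove_node k (weight (shape a k 3))) (fun j => (j == k)%:R + (j == k.+2)%:R) F.
Proof.
have a1 := a_gt1; have [F hF] := sym3_class_shape k.+1; rewrite remove_shape in hF.
apply: (@sym4_class _ _ k.+4 F) => //.
- by apply: narrow_shape; lia.
all: try by rewrite !weight_shape; do ?[case: ifP => ?]; lia.
by move=> j; exact: shape_raise_unit.
Qed.

(** As y is (1,0) on the rows s and s+1, it could be proportional to the row
    lengths plus 1 only if L_(s+1) + 1 = 2 were divisible by 3. *)
Lemma C2_shape b k r s F y :
  (0 < b)%N -> (k = 0 \/ 1 < b)%N -> (1 < r)%N -> (s <= k.+1)%N ->
  weight (shape b k r) s.+1 = 1%N -> weight (shape b k r) s.+2 = 1%N ->
  raises (weight (shape b k r)) y F -> y s = 1 -> y s.+1 = 0 ->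
  C2 3 (shape b k r).
Proof.
move=> b_gt0 bk r_gt1 le_s L1 L2 hF y1 y0.
exists (sumn (shape b k r)); first exact: shape_partition.
apply: (specht_H2_nontrivial (shape_partition r b_gt0 bk) (narrow_shape r b_gt0 bk) hF (r := s)).
- by rewrite L1.
- by rewrite L2.
by rewrite y1 y0 L1 mul0r subr0 mul1r.
Qed.

(** Removing a node from the last row of length 2 of (a,2^(k+1),1^2) leaves
    (a,2^k,1^3). *)
Lemma C2_shape3 k : C2 3 (shape a k 3).
Proof.
have a1 := a_gt1; have [F] := sym3_class_shape k.+1; rewrite remove_shape => hF.
apply: (C2_shape (s := k.+1)) hF _ _ => //; try lia.
- by rewrite weight_shape; do ?[case: ifP => ?]; lia.
- by rewrite weight_shape; do ?[case: ifP => ?]; lia.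
Qed.

Lemma C2_shape4 k : C2 3 (shape a k 4).
Proof.
have a1 := a_gt1; have [F] := sym4_class_shape k.+1; rewrite remove_shape => hF.
apply: (C2_shape (s := k.+1)) hF _ _ => //; try lia.
- by rewrite weight_shape; do ?[case: ifP => ?]; lia.
- by rewrite weight_shape; do ?[case: ifP => ?]; lia.
Qed.

(** The same construction for (a,1^2), where the node is taken from the first
    row. *)
Lemma C2_hook2 : C2 3 (shape a.-1 0 2).
Proof.
have a1 := a_gt1; have [F] := sym3_class_shape 0; rewrite remove_shape0 => hF.
by apply: (C2_shape (s := 0%N)) hF _ _ => //; lia.
Qed.

Lemma C2_hook3 : C2 3 (shape a.-1 0 3).
Proof.
have a1 := a_gt1; have [F] := sym4_class_shape 0; rewrite remove_shape0 => hF.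
by apply: (C2_shape (s := 0%N)) hF _ _ => //; lia.
Qed.

End FirstColumns.

Lemma not_C2 l : is_partition (sumn l) l -> narrow (weight l) ->
  (forall F y, raises (weight l) y F ->
     exists a, forall j, (0 < weight l j.+1)%N ->
       (3 %| y j - a * (weight l j).+1%:R)%Z) ->
  ~ C2 3 l.
Proof.
move=> part_l yl hl [n part_n]; have /and3P[_ _ /eqP n_l] := part_n.
by rewrite -{}n_l; exact: specht_H2_trivial.
Qed.

(** * The start vertex has no predecessor *)

(** There is only one constant y_0, and L_0 + 1 is a unit modulo 3. *)
Lemma not_C2_two_rows b : (0 < b)%N -> (3 %| b.+2)%N -> ~ C2 3 (shape b 0 1).
Proof.
move=> b_gt0 b_mod3; have b0 : 0 = 0 :> nat \/ (1 < b)%N by left.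
apply: not_C2; [exact: shape_partition | exact: narrow_shape | move=> F y _].
exists (- y 0%N) => -[|j]; last by rewrite weight_shape.
move=> _; rewrite weight_shape /= mulNr opprK -[X in X + _]mulr1 -mulrDr.
by rewrite dvdz_mull // -[1]/(1%:R) -natrD natz.
Qed.

Section Hook.

Variables (b n : nat) (F : seq nat -> int) (y : nat -> int).
Hypothesis n_eq : n = b.+2.

Let L := weight (shape b 0 2).

Hypothesis hF : raises L y F.

(** The tabloid of shape (b,1,1) with the letters x and z in the rows 1 and 2. *)
Definition hook_word (x z : nat) : seq nat :=
  set_nth 0%N (set_nth 0%N (nseq n 0%N) x 1%N) z 2%N.

Lemma size_word1 (x v : nat) : (x < n)%N -> size (set_nth 0%N (nseq n 0%N) x v) = n.
Proof. by move=> lt_x; rewrite size_set_nth size_nseq (maxn_idPr lt_x). Qed.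

Lemma nth_word1 (x v i : nat) : (i < n)%N ->
  nth 0%N (set_nth 0%N (nseq n 0%N) x v) i = if i == x then v else 0%N.
Proof. by move=> lt_i; rewrite nth_set_nth /= nth_nseq if_same. Qed.

Lemma count_word1 (x v i : nat) : (x < n)%N ->
  (count_mem i (set_nth 0%N (nseq n 0%N) x v) + (0 == i) = (0 == i) * n + (v == i))%N.
Proof.
move=> lt_x; have := count_mem_set_nth i v (T := nseq n 0%N) (x := x).
by rewrite size_nseq nth_nseq if_same count_nseq => ->.
Qed.

Lemma hook_raise0 z : (z < n)%N ->
  (3 %| \sum_(x < n | x != z :> nat) F (hook_word x z) - y 0%N)%Z.
Proof.
move=> lt_z; pose T := set_nth 0%N (nseq n 0%N) z 2%N.
have szT : size T = n := size_word1 2 lt_z.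
have hT : raised 0 L T.
  move=> i; have := count_word1 2 i lt_z; rewrite -/T /L weight_shape n_eq.
  by case: i => [|[|[|i]]] /=; move: (count _ _); lia.
have := hF hT; rewrite (raise_size _ _ szT); congr (_ %| _ - _)%Z.
apply: eq_big => [x|x]; rewrite nth_word1 //; first by case: (x == z :> nat).
case: (x =P z :> nat) => // /eqP ne_x _; congr F; rewrite /hook_word.
by rewrite [in RHS]set_set_nth ifN // eq_sym.
Qed.

Lemma hook_raise1 x z : (x < n)%N -> (z < n)%N -> x != z ->
  (3 %| F (hook_word x z) + F (hook_word z x) - y 1%N)%Z.
Proof.
move=> lt_x lt_z ne_xz; pose T := set_nth 0%N (set_nth 0%N (nseq n 0%N) x 1%N) z 1%N.
have lt_z' : (z < size (set_nth 0%N (nseq n 0%N) x 1%N))%N by rewrite size_word1.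
have szT : size T = n by rewrite /T size_set_nth size_word1 // (maxn_idPr lt_z).
have hT : raised 1 L T.
  move=> i; have := count_word1 1 i lt_x; have := count_mem_set_nth i 1%N lt_z'.
  rewrite -/T /L weight_shape nth_word1 // ifN 1?eq_sym // n_eq.
  by case: i => [|[|[|i]]] /=; move: (count _ _); lia.
have := hF hT; rewrite (raise_pair F (x := z) (y := x)) ?szT //.
- have -> : set_nth 0%N T z 2%N = hook_word x z by rewrite /T set_set_nth eqxx.
  have -> // : set_nth 0%N T x 2%N = hook_word z x.
  rewrite /T /hook_word [LHS]set_set_nth (ifN_eqC _ _ ne_xz) [X in set_nth _ X _ _ = _]set_set_nth eqxx.
  by rewrite [RHS]set_set_nth (ifN_eqC _ _ ne_xz).
- by rewrite eq_sym.
- by rewrite /T nth_set_nth /= eqxx.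
- by rewrite /T nth_set_nth /= ifN // nth_word1 // eqxx.
by have := hT 1%N; rewrite /L weight_shape /=; lia.
Qed.

(** Double counting of F over all ordered pairs (x,z) of distinct letters: fixing
    z gives n y_0, and pairing (x,z) with (z,x) gives n(n-1)/2 times y_1. Here
    n = b + 2 is 2 modulo 3, so y_1 = 2 y_0 modulo 3. *)
Lemma hook_relation : (3 %| b)%N -> (3 %| y 1%N - 2 * y 0%N)%Z.
Proof.
move=> /dvdnP[c b_eq]; pose u (x z : 'I_n) := F (hook_word x z).
pose A := \sum_z \sum_(x | x != z) u x z.
have hA : (3 %| A - n%:Z * y 0%N)%Z.
  have -> : A - n%:Z * y 0%N = \sum_z (\sum_(x | x != z) u x z - y 0%N).
    by rewrite sumrB sumr_const card_ord -mulr_natl natz.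
  by apply: rpred_sum => z _; exact: (hook_raise0 (ltn_ord z)).
have hB : (3 %| A + A - n%:Z * b.+1%:Z * y 1%N)%Z.
  have {2}-> : A = \sum_z \sum_(x | x != z) u z x.
    rewrite /A (exchange_big_dep xpredT) //=; apply: eq_bigr => x _.
    by apply: eq_bigl => z; rewrite eq_sym.
  rewrite -big_split /=.
  have -> : \sum_z (\sum_(x | x != z) u x z + \sum_(x | x != z) u z x) - n%:Z * b.+1%:Z * y 1%N
    = \sum_z \sum_(x | x != z) (u x z + u z x - y 1%N).
    rewrite [RHS](eq_bigr (fun z => \sum_(x | x != z) u x z + \sum_(x | x != z) u z x - b.+1%:Z * y 1%N)).
      by rewrite sumrB sumr_const card_ord -mulr_natl natz mulrA.
    move=> z _; rewrite sumrB big_split /= sumr_const -mulr_natl natz; congr (_ - _%:Z * _).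
    by rewrite (eq_card (B := predC1 z)) // cardC1 card_ord n_eq.
  by apply: rpred_sum => z _; apply: rpred_sum => x ne_xz; exact: hook_raise1 (ltn_ord x) (ltn_ord z) ne_xz.
have := rpredB hB (rpredD hA hA).
have -> : A + A - n%:Z * b.+1%:Z * y 1%N - (A - n%:Z * y 0%N + (A - n%:Z * y 0%N)) =
    (2 * y 0%N - y 1%N) * 2 + 3 * (c%:Z * 2 * y 0%N - (3 * c%:Z ^+ 2 + 3 * c%:Z) * y 1%N).
  have -> : n%:Z = 3 * c%:Z + 2 by rewrite n_eq b_eq; lia.
  have -> : b.+1%:Z = 3 * c%:Z + 1 by rewrite b_eq; lia.
  ring.
rewrite addrC => h; apply: two_cancel3; rewrite -rpredN -mulNr opprB.
by apply: dvdz_addl _ h; exact: dvdz_mulr.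
Qed.

End Hook.

Lemma not_C2_hook b : (0 < b)%N -> (3 %| b)%N -> ~ C2 3 (shape b 0 2).
Proof.
move=> b_gt0 b_mod3; have b0 : 0 = 0 :> nat \/ (1 < b)%N by left.
apply: not_C2; [exact: shape_partition | exact: narrow_shape | move=> F y hF].
exists (y 0%N) => -[|[|j]]; rewrite !weight_shape //= => _; last first.
  by rewrite mulrC; exact: hook_relation erefl hF b_mod3.
have -> : y 0%N - y 0%N * b.+1%:R = - y 0%N * b%:Z by rewrite natz -addn1 PoszD; ring.
by rewrite dvdz_mull.
Qed.

(** * The path *)
Definition path3 (m i : nat) : seq nat :=
  match i with
  | 0 => shape (3 * m - 2) 0 2
  | 1 => shape (3 * m - 2) 0 3
  | j.+2 => shape (3 * m - 1) j./2 (3 + odd j)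
  end.

Lemma sumn_path3 m i : (1 <= m)%N -> sumn (path3 m i) = (3 * m + i)%N.
Proof.
by move=> hm; case: i => [|[|j]]; rewrite sumn_shape; last have := odd_double_half j; lia.
Qed.

Lemma C2_path3 m i : (1 <= m)%N -> C2 3 (path3 m i).
Proof.
move=> hm; have a_mod3 : (3 %| (3 * m - 1).+1)%N by rewrite subn1 prednK ?dvdn_mulr //; lia.
have eq_a : (3 * m - 2)%N = (3 * m - 1).-1 by lia.
case: i => [|[|j]] /=; rewrite ?eq_a; [exact: C2_hook2|exact: C2_hook3|].
by case: odd; [exact: C2_shape4|exact: C2_shape3].
Qed.

Lemma incr_shape0 a k r : incr_nth (shape a k r) 0 = shape a.+1 k r.
Proof. by []. Qed.

Lemma incr_shape_new a k r : incr_nth (shape a k r) (k + r).+1 = shape a k r.+1.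
Proof.
rewrite /shape /=; congr (_ :: _); elim: k => [|k IH] /=; last by rewrite IH.
by elim: r => //= r ->.
Qed.

Lemma incr_shape_second a k r : incr_nth (shape a k r.+1) k.+1 = shape a k.+1 r.
Proof. by rewrite /shape /=; congr (_ :: _); elim: k => //= k ->. Qed.

Lemma path3_step m i : (1 <= m)%N -> exists k, path3 m i.+1 = incr_nth (path3 m i) k.
Proof.
move=> hm; case: i => [|[|j]]; rewrite /path3.
- by exists 3; rewrite -incr_shape_new.
- exists 0%N; rewrite incr_shape0 /=; congr (shape _ 0 3); lia.
case: (boolP (odd j)) => odd_j.
  exists (j./2).+1; rewrite incr_shape_second /= odd_j uphalf_half odd_j.
  by [].
exists (j./2 + 3).+1; rewrite incr_shape_new /= odd_j uphalf_half (negbTE odd_j).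
by [].
Qed.

(** The node that is added lies in one of the three rows of (3m-2,1,1). It cannot
    be the one in the middle row, as the smaller diagram would have an empty row
    above a nonempty one. *)
Lemma path3_start m l i : (1 <= m)%N ->
  is_partition (sumn l) l -> incr_nth l i = shape (3 * m - 2) 0 2 ->
  l = shape (3 * m - 2) 0 1 \/ (1 < m)%N /\ l = shape (3 * m - 3) 0 2.
Proof.
move=> hm /and3P[_ l_pos _] eq_l.
have nth_l k : (nth 0 l k + (i == k) = nth 0 (shape (3 * m - 2) 0 2) k)%N.
  by rewrite -eq_l nth_incr_nth addnC.
have l_gt0 k : (k < size l)%N -> nth 0%N l k != 0%N.
  by move=> lt_k; apply: contraNneq l_pos => <-; exact: mem_nth.
have i_lt3 : (i < 3)%N.
  rewrite ltnNge; apply/negP => le_3i; have := nth_l i.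
  by rewrite eqxx [in RHS]nth_default // addn1.
have := (nth_l 0%N, nth_l 1%N, nth_l 2%N, (l_gt0 0%N, l_gt0 1%N, l_gt0 2%N)).
have l_le k : nth 0%N l k.+3 = 0%N.
  by have := nth_l k.+3; rewrite /= nth_nil => /eqP; rewrite addn_eq0 => /andP[/eqP].
have szl : (size l <= 3)%N.
  by rewrite leqNgt; apply/negP => /l_gt0; rewrite l_le.
case: l szl {nth_l l_gt0 l_le l_pos eq_l} => [|x [|z [|t [|? ?]]]] //= _; rewrite /shape /=.
all: move=> [[[h0 h1] h2] [[p0 p1] p2]].
- lia.
- lia.
- left; have -> : x = (3 * m - 2)%N by lia.
  by have -> : z = 1%N by lia.
right; have := p0 isT; have := p1 isT; have := p2 isT => {}p2 {}p1 {}p0.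
split; first by lia.
have -> : x = (3 * m - 3)%N by lia.
have -> : z = 1%N by lia.
by have -> : t = 1%N by lia.
Qed.

Lemma path3_path m : (1 <= m)%N -> is_path 3 (path3 m).
Proof.
move=> hm; split=> [i j eq_ij|i|l [C2l _ [i eq_l]]].
- by have := congr1 sumn eq_ij; rewrite !sumn_path3 // => /addnI.
- by split; [exact: C2_path3 | exact: C2_path3 | exact: path3_step].
have part_l : is_partition (sumn l) l.
  by have [n part_n _] := C2l; have /and3P[_ _ /eqP ->] := part_n.
case: (path3_start hm part_l (esym eq_l)) C2l => [->|[m_gt1 ->]].
  by apply: not_C2_two_rows; lia.
by apply: not_C2_hook; lia.
Qed.

Local Close Scope ring_scope.

Theorem lemma6p4 (m : nat) (hm : (1 <= m)%N) :
  exists P : nat -> seq nat,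
    [/\ is_path 3 P,
        P 0%N = (3 * m - 2)%N :: nseq 2 1%N,
        P 1%N = (3 * m - 2)%N :: nseq 3 1%N &
        [/\ P 2%N = (3 * m - 1)%N :: nseq 3 1%N,
            P 3%N = (3 * m - 1)%N :: nseq 4 1%N &
            P 4%N = (3 * m - 1)%N :: 2%N :: nseq 3 1%N]].
Proof. by exists (path3 m); split=> //; exact: path3_path. Qed.
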